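(* Let $k \ge 5$ be a natural number, let $h_k$ be a non-zero homogeneous harmonic polynomial of degree $k$ in two real variables $x,y$, and let $R$ be a $C^\infty$ function-germ at $\mathbf{0} \in \mathbf{R}^2$ of order more than $k$ such that $\Delta^2 R = 0$. Then $h_k$ and $h_k + R$ are right equivalent.
   Context: $\Delta = \frac{\partial^2}{\partial x^2} + \frac{\partial^2}{\partial y^2}$ is the Laplacian on $\mathbf{R}^2$ and $\Delta^2 R = \Delta(\Delta R)$; a polynomial $h$ is harmonic if $\Delta h = 0$. Let $\mathfrak{m}_2$ be the ideal of germs vanishing at $\mathbf{0}$ in the ring of $C^\infty$ function-germs $(\mathbf{R}^2,\mathbf{0}) \to \mathbf{R}$; that $R$ has order more than $k$ means $R \in \mathfrak{m}_2^{k+1}$. Two germs $h_1,h_2 \colon (\mathbf{R}^2,\mathbf{0}) \to (\mathbf{R},0)$ are right equivalent if there is a $C^\infty$ diffeomorphism-germ $\varphi \colon (\mathbf{R}^2,\mathbf{0}) \to (\mathbf{R}^2,\mathbf{0})$ with $h_1 \circ \varphi = h_2$. *)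

(* Defs.v *)
From Stdlib Require Import Reals List.
From Coquelicot Require Import Coquelicot.
Open Scope R_scope.

(* A function-germ at the origin of the plane is given by a representative
   [f : R -> R -> R]; only its values near (0, 0) matter, and equality of germs
   is [germ_eq]. *)

Definition germ_eq (f g : R -> R -> R) : Prop :=
  locally_2d (fun x y => f x y = g x y) 0 0.

(* [ex_diff_n f n] at all points of an open set means that [f] is of class C^n
   there. The neighbourhood of the origin is chosen before [n]. *)
Definition smooth_germ (f : R -> R -> R) : Prop :=
  locally_2d (fun x y => forall n : nat, ex_diff_n f n x y) 0 0.

Definition m2 (f : R -> R -> R) : Prop := smooth_germ f /\ f 0 0 = 0.

(* Product of ideals: the germs of finite sums of products u * v with u in I
   and v in J. *)
Definition ideal_mul (I J : (R -> R -> R) -> Prop) (f : R -> R -> R) : Prop :=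
  exists l : list ((R -> R -> R) * (R -> R -> R)),
    List.Forall (fun p => I (fst p) /\ J (snd p)) l /\
    germ_eq f
      (fun x y => fold_right Rplus 0 (List.map (fun p => fst p x y * snd p x y) l)).

Fixpoint ideal_pow (I : (R -> R -> R) -> Prop) (n : nat) :
    (R -> R -> R) -> Prop :=
  match n with
  | O => smooth_germ
  | S n' => ideal_mul I (ideal_pow I n')
  end.

Definition order_more_than (k : nat) (f : R -> R -> R) : Prop :=
  ideal_pow m2 (S k) f.

Definition laplacian (f : R -> R -> R) (x y : R) : R :=
  partial_derive 2 0 f x y + partial_derive 0 2 f x y.

(* The homogeneous polynomial of degree k with coefficients a 0, ..., a k;
   the values a i with i > k play no role. *)
Definition hom_poly (k : nat) (a : nat -> R) (x y : R) : R :=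
  sum_f_R0 (fun i => a i * x ^ (k - i) * y ^ i) k.

Definition harmonic (f : R -> R -> R) : Prop :=
  forall x y : R, laplacian f x y = 0.

(* The components of a map-germ (R^2, 0) -> (R^2, 0) are (f1, f2). *)
Definition smooth_map_germ (f1 f2 : R -> R -> R) : Prop :=
  m2 f1 /\ m2 f2.

Definition diffeo_germ (f1 f2 : R -> R -> R) : Prop :=
  smooth_map_germ f1 f2 /\
  exists g1 g2 : R -> R -> R,
    smooth_map_germ g1 g2 /\
    germ_eq (fun x y => g1 (f1 x y) (f2 x y)) (fun x _ => x) /\
    germ_eq (fun x y => g2 (f1 x y) (f2 x y)) (fun _ y => y) /\
    germ_eq (fun x y => f1 (g1 x y) (g2 x y)) (fun x _ => x) /\
    germ_eq (fun x y => f2 (g1 x y) (g2 x y)) (fun _ y => y).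

Definition right_equivalent (h1 h2 : R -> R -> R) : Prop :=
  exists f1 f2 : R -> R -> R,
    diffeo_germ f1 f2 /\
    germ_eq (fun x y => h1 (f1 x y) (f2 x y)) h2.

(* Main.v *)
Require Import Defs.
From Stdlib Require Import Reals.
From Coquelicot Require Import Coquelicot.
From Stdlib Require Import Lra Lia List.
Open Scope R_scope.

(** The plane is read as the complex line, with coordinate z.

    Expand a smooth function f by Taylor's formula with integral remainder,
    organised by monomials in z and its conjugate w: the coefficient of
    z^i w^j is a multiple of the mixed Wirtinger derivative of type (i, j) of f
    at the origin.  A derivative of type (i, j) is zero when i + j is less than
    the order of vanishing, and since the Laplacian is four times the derivative of
    type (1, 1), f being p-harmonic kills all types with i, j >= p.  Every
    remainder term of total degree 2k is divisible by z^k or w^k.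

    For p = 1 and the form h = h_k this leaves only z^k and w^k, and
    homogeneity gives h = Re (c z^k) with c <> 0 ([harmonic_form]).  For p = 2
    and f = R of order more than k, the surviving terms have i <= 1 or j <= 1
    and i + j >= k + 1, hence are proper multiples of z^k or w^k; so
    R = Re (z^k A) with A smooth and A(0) = 0
    ([real_part_of_power_multiple]).  Taylor's formula up to degree 2k is all
    that this uses of R, so smoothness suffices.

    Consequently h + R = Re (c z^k (1 + A / c)).  The unit 1 + A / c has a
    smooth k-th root 1 + V with V(0) = 0 ([complex_root_germ]), and
    phi = z (1 + V) satisfies h o phi = Re (c z^k (1 + V)^k) = h + R.  Because
    phi is tangent to the identity at the origin, the inverse function theorem
    ([diffeo_germ_of_tangent_identity]) makes it a diffeomorphism germ.  The
    root itself comes from the same theorem, applied to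
    ((1 + z)^k - 1) / k = z (1 + Q) with Q(0) = 0.

    The analytic input is a calculus of smooth functions closed under ring
    operations, composition, weighted means along rays (for the remainders)
    and local inversion. *)

(** * Smooth functions on an open set *)

Definition open_plane (U : R -> R -> Prop) : Prop :=
  forall x y, U x y -> locally_2d U x y.

Definition box (d x y : R) : Prop := Rabs x < d /\ Rabs y < d.

Lemma box_open (d : R) : open_plane (box d).
Proof.
  intros x y [Hx Hy].
  assert (He : 0 < Rmin (d - Rabs x) (d - Rabs y)) by (apply Rmin_pos; lra).
  exists (mkposreal _ He); simpl; intros u v Hu Hv.
  pose proof (Rmin_l (d - Rabs x) (d - Rabs y)).
  pose proof (Rmin_r (d - Rabs x) (d - Rabs y)).
  pose proof (Rabs_triang (u - x) x); pose proof (Rabs_triang (v - y) y).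
  replace (u - x + x) with u in * by ring.
  replace (v - y + y) with v in * by ring.
  split; lra.
Qed.

(** Smoothness is treated coinductively: a function is smooth when it lies in
    some family of differentiable functions closed under partial derivatives.
    A closure property is then proved by exhibiting one family, with no
    induction on the order of differentiability. *)
Definition stable (U : R -> R -> Prop) (P : (R -> R -> R) -> Prop) : Prop :=
  forall g, P g -> exists gx gy, P gx /\ P gy /\
    forall x y, U x y -> differentiable_pt_lim g x y (gx x y) (gy x y).

Definition smooth_on (U : R -> R -> Prop) (f : R -> R -> R) : Prop :=
  exists P, stable U P /\ P f.

Definition dx (f : R -> R -> R) (x y : R) : R := Derive (fun t => f t y) x.
Definition dy (f : R -> R -> R) (x y : R) : R := Derive (fun t => f x t) y.

(** By the Leibniz rule, an algebra of functions is closed under derivatives as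
    soon as the derivatives of its generators lie in it; sums, products,
    composites and inverses are all handled by choosing the generators. *)
Inductive algebra (P : (R -> R -> R) -> Prop) : (R -> R -> R) -> Prop :=
  | algebra_gen f : P f -> algebra P f
  | algebra_const c : algebra P (fun _ _ => c)
  | algebra_plus f g : algebra P f -> algebra P g -> algebra P (fun x y => f x y + g x y)
  | algebra_mult f g : algebra P f -> algebra P g -> algebra P (fun x y => f x y * g x y).

Lemma differentiable_pt_lim_const (c x y : R) :
  differentiable_pt_lim (fun _ _ => c) x y 0 0.
Proof.
  intros eps; apply locally_2d_forall; intros u v.
  replace (c - c - _) with 0 by ring; rewrite Rabs_R0.
  apply Rmult_le_pos; [apply Rlt_le, eps|].
  apply Rle_trans with (1 := Rabs_pos (u - x)), Rmax_l.
Qed.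

Lemma differentiable_pt_lim_linear (a b x y : R) :
  differentiable_pt_lim (fun u v => a * u + b * v) x y a b.
Proof.
  intros eps; apply locally_2d_forall; intros u v.
  replace (_ - _) with 0 by ring; rewrite Rabs_R0.
  apply Rmult_le_pos; [apply Rlt_le, eps|].
  apply Rle_trans with (1 := Rabs_pos (u - x)), Rmax_l.
Qed.

Lemma differentiable_pt_lim_eq (f : R -> R -> R) (x y lx ly mx my : R) :
  differentiable_pt_lim f x y lx ly -> lx = mx -> ly = my ->
  differentiable_pt_lim f x y mx my.
Proof. intros H <- <-; exact H. Qed.

Lemma differentiable_pt_lim_plus (f g : R -> R -> R) (x y fx fy gx gy : R) :
  differentiable_pt_lim f x y fx fy -> differentiable_pt_lim g x y gx gy ->
  differentiable_pt_lim (fun u v => f u v + g u v) x y (fx + gx) (fy + gy).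
Proof.
  intros Hf Hg.
  apply (differentiable_pt_lim_ext (fun u v => 1 * f u v + 1 * g u v)).
  { apply locally_2d_forall; intros; ring. }
  eapply differentiable_pt_lim_eq.
  - exact (differentiable_pt_lim_comp (fun u v => 1 * u + 1 * v) f g x y
             _ _ _ _ _ _ (differentiable_pt_lim_linear 1 1 _ _) Hf Hg).
  - ring.
  - ring.
Qed.

Lemma differentiable_pt_lim_mult (f g : R -> R -> R) (x y fx fy gx gy : R) :
  differentiable_pt_lim f x y fx fy -> differentiable_pt_lim g x y gx gy ->
  differentiable_pt_lim (fun u v => f u v * g u v) x y
    (fx * g x y + f x y * gx) (fy * g x y + f x y * gy).
Proof.
  intros Hf Hg.
  assert (Hm : forall a b, differentiable_pt_lim Rmult a b b a).
  { intros a b eps; exists eps; intros u v Hu Hv.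
    replace (_ - _) with ((u - a) * (v - b)) by ring.
    rewrite Rabs_mult.
    apply Rmult_le_compat; try apply Rabs_pos; [lra|apply Rmax_r]. }
  eapply differentiable_pt_lim_eq.
  - exact (differentiable_pt_lim_comp Rmult f g x y _ _ _ _ _ _ (Hm _ _) Hf Hg).
  - ring.
  - ring.
Qed.

Lemma algebra_stable (U : R -> R -> Prop) (P : (R -> R -> R) -> Prop) :
  (forall g, P g -> exists gx gy, algebra P gx /\ algebra P gy /\
     forall x y, U x y -> differentiable_pt_lim g x y (gx x y) (gy x y)) ->
  stable U (algebra P).
Proof.
  intros HP g Hg; induction Hg as [g Hg|c|f g Hf [fx [fy [Hfx [Hfy Df]]]]
    Hg [gx [gy [Hgx [Hgy Dg]]]]|f g Hf [fx [fy [Hfx [Hfy Df]]]]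
    Hg [gx [gy [Hgx [Hgy Dg]]]]].
  - exact (HP g Hg).
  - exists (fun _ _ => 0), (fun _ _ => 0); repeat split; try apply algebra_const.
    intros; apply differentiable_pt_lim_const.
  - exists (fun x y => fx x y + gx x y), (fun x y => fy x y + gy x y).
    split; [|split]; try (apply algebra_plus; assumption).
    intros x y Hxy; apply differentiable_pt_lim_plus; auto.
  - exists (fun x y => fx x y * g x y + f x y * gx x y),
      (fun x y => fy x y * g x y + f x y * gy x y).
    split; [|split]; try (apply algebra_plus; apply algebra_mult; assumption).
    intros x y Hxy; apply differentiable_pt_lim_mult; auto.
Qed.

Lemma stable_smooth_on (U : R -> R -> Prop) : stable U (smooth_on U).
Proof.
  intros g [P [HP Hg]]; destruct (HP g Hg) as [gx [gy [Hx [Hy D]]]].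
  exists gx, gy; split; [exists P; auto|split; [exists P; auto|exact D]].
Qed.

Lemma smooth_on_algebra (U : R -> R -> Prop) (f : R -> R -> R) :
  algebra (smooth_on U) f -> smooth_on U f.
Proof.
  intros Hf; exists (algebra (smooth_on U)); split; [|exact Hf].
  apply algebra_stable; intros g Hg.
  destruct (stable_smooth_on U g Hg) as [gx [gy [Hx [Hy D]]]].
  exists gx, gy; split; [|split]; [apply algebra_gen..|]; assumption.
Qed.

Lemma smooth_on_const (U : R -> R -> Prop) (c : R) : smooth_on U (fun _ _ => c).
Proof. apply smooth_on_algebra, algebra_const. Qed.

Lemma smooth_on_plus (U : R -> R -> Prop) (f g : R -> R -> R) :
  smooth_on U f -> smooth_on U g -> smooth_on U (fun x y => f x y + g x y).
Proof. intros; apply smooth_on_algebra, algebra_plus; apply algebra_gen; assumption. Qed.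

Lemma smooth_on_mult (U : R -> R -> Prop) (f g : R -> R -> R) :
  smooth_on U f -> smooth_on U g -> smooth_on U (fun x y => f x y * g x y).
Proof. intros; apply smooth_on_algebra, algebra_mult; apply algebra_gen; assumption. Qed.

Lemma smooth_on_linear (U : R -> R -> Prop) (a b : R) :
  smooth_on U (fun x y => a * x + b * y).
Proof.
  exists (algebra (fun f => f = fun x y => a * x + b * y)).
  split; [|apply algebra_gen; reflexivity].
  apply algebra_stable; intros g ->.
  exists (fun _ _ => a), (fun _ _ => b); split; [|split]; try apply algebra_const.
  intros; apply differentiable_pt_lim_linear.
Qed.

Lemma smooth_on_ext (U : R -> R -> Prop) (f g : R -> R -> R) :
  open_plane U -> (forall x y, U x y -> f x y = g x y) ->
  smooth_on U f -> smooth_on U g.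
Proof.
  intros HU Hfg [P [HP Hf]].
  exists (fun h => exists h', P h' /\ forall x y, U x y -> h' x y = h x y).
  split; [|exists f; auto].
  intros h [h' [Hh' E]]; destruct (HP h' Hh') as [gx [gy [Hx [Hy D]]]].
  exists gx, gy; split; [exists gx; auto|split; [exists gy; auto|]].
  intros x y Hxy; apply (differentiable_pt_lim_ext h'); [|apply D, Hxy].
  destruct (HU x y Hxy) as [d Hd]; exists d; auto.
Qed.

Lemma smooth_on_fst (U : R -> R -> Prop) : open_plane U -> smooth_on U (fun x _ => x).
Proof.
  intros HU; apply (smooth_on_ext U (fun x y => 1 * x + 0 * y)); auto.
  - intros; ring.
  - apply smooth_on_linear.
Qed.

Lemma smooth_on_snd (U : R -> R -> Prop) : open_plane U -> smooth_on U (fun _ y => y).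
Proof.
  intros HU; apply (smooth_on_ext U (fun x y => 0 * x + 1 * y)); auto.
  - intros; ring.
  - apply smooth_on_linear.
Qed.

Lemma smooth_on_opp (U : R -> R -> Prop) (f : R -> R -> R) :
  open_plane U -> smooth_on U f -> smooth_on U (fun x y => - f x y).
Proof.
  intros HU Hf; apply (smooth_on_ext U (fun x y => (-1) * f x y)); auto.
  - intros; ring.
  - apply smooth_on_mult; [apply smooth_on_const|exact Hf].
Qed.

Lemma smooth_on_minus (U : R -> R -> Prop) (f g : R -> R -> R) :
  open_plane U ->
  smooth_on U f -> smooth_on U g -> smooth_on U (fun x y => f x y - g x y).
Proof. intros; apply smooth_on_plus; [|apply smooth_on_opp]; assumption. Qed.

Lemma smooth_on_sub (U V : R -> R -> Prop) (f : R -> R -> R) :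
  (forall x y, U x y -> V x y) -> smooth_on V f -> smooth_on U f.
Proof.
  intros HUV [P [HP Hf]]; exists P; split; [|exact Hf].
  intros g Hg; destruct (HP g Hg) as [gx [gy [Hx [Hy D]]]].
  exists gx, gy; auto.
Qed.

Lemma smooth_on_comp (U V : R -> R -> Prop) (f u v : R -> R -> R) :
  (forall x y, U x y -> V (u x y) (v x y)) ->
  smooth_on V f -> smooth_on U u -> smooth_on U v ->
  smooth_on U (fun x y => f (u x y) (v x y)).
Proof.
  intros HUV Hf Hu Hv.
  set (P := fun g => smooth_on U g \/
    exists g', smooth_on V g' /\ g = fun x y => g' (u x y) (v x y)).
  exists (algebra P); split.
  - apply algebra_stable; intros g [Hg|[g' [Hg' ->]]].
    + destruct (stable_smooth_on U g Hg) as [gx [gy [Hx [Hy D]]]].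
      exists gx, gy; split; [|split]; [apply algebra_gen; left..|]; assumption.
    + destruct (stable_smooth_on V g' Hg') as [gx [gy [Hx [Hy D]]]].
      destruct (stable_smooth_on U u Hu) as [ux [uy [Hux [Huy Du]]]].
      destruct (stable_smooth_on U v Hv) as [vx [vy [Hvx [Hvy Dv]]]].
      exists (fun x y => gx (u x y) (v x y) * ux x y + gy (u x y) (v x y) * vx x y),
        (fun x y => gx (u x y) (v x y) * uy x y + gy (u x y) (v x y) * vy x y).
      split; [|split].
      * apply algebra_plus; apply algebra_mult; apply algebra_gen;
          solve [left; assumption | right; eexists; split; [|reflexivity]; assumption].
      * apply algebra_plus; apply algebra_mult; apply algebra_gen;
          solve [left; assumption | right; eexists; split; [|reflexivity]; assumption].
      * intros x y Hxy; apply differentiable_pt_lim_comp; auto.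
  - apply algebra_gen; right; exists f; auto.
Qed.

(** Adjoining 1/f to the smooth functions suffices, since its derivatives
    - f' (1/f) (1/f) are again in the algebra. *)
Lemma smooth_on_inv (U : R -> R -> Prop) (f : R -> R -> R) :
  (forall x y, U x y -> f x y <> 0) ->
  smooth_on U f -> smooth_on U (fun x y => / f x y).
Proof.
  intros Hnz Hf.
  exists (algebra (fun g => smooth_on U g \/ g = fun x y => / f x y)); split.
  - apply algebra_stable; intros g [Hg| -> ].
    + destruct (stable_smooth_on U g Hg) as [gx [gy [Hx [Hy D]]]].
      exists gx, gy; split; [|split]; [apply algebra_gen; left..|]; assumption.
    + destruct (stable_smooth_on U f Hf) as [fx [fy [Hx [Hy D]]]].
      exists (fun x y => ((-1) * fx x y) * (/ f x y * / f x y)),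
        (fun x y => ((-1) * fy x y) * (/ f x y * / f x y)).
      split; [|split].
      1, 2: repeat apply algebra_mult; try apply algebra_const; apply algebra_gen; auto.
      intros x y Hxy.
      eapply differentiable_pt_lim_eq.
      * apply (differentiable_pt_lim_comp (fun a _ => / a) f f x y (- / (f x y)²) 0
                 (fx x y) (fy x y) (fx x y) (fy x y)); auto.
        apply (differentiable_pt_lim_proj1_0 (fun a => / a)).
        apply is_derive_Reals.
        evar_last. apply (is_derive_inv (fun a => a)); [apply is_derive_id|auto].
        unfold one; simpl; unfold Rsqr; field; auto.
      * unfold Rsqr; field; auto.
      * unfold Rsqr; field; auto.
  - apply algebra_gen; right; reflexivity.
Qed.

(** The partial derivatives provided by a stable family are existentially
    quantified; on an open set they agree with [dx] and [dy], which can
    therefore be used from here on. *)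
Lemma smooth_on_derivatives (U : R -> R -> Prop) (f : R -> R -> R) :
  open_plane U -> smooth_on U f ->
  smooth_on U (dx f) /\ smooth_on U (dy f) /\
  forall x y, U x y -> differentiable_pt_lim f x y (dx f x y) (dy f x y).
Proof.
  intros HU Hf; destruct (stable_smooth_on U f Hf) as [fx [fy [Hx [Hy D]]]].
  assert (E : forall x y, U x y -> dx f x y = fx x y /\ dy f x y = fy x y).
  { intros x y Hxy; exact (differentiable_pt_lim_unique f x y _ _ (D x y Hxy)). }
  split; [|split].
  - apply (smooth_on_ext U fx); auto; intros x y Hxy; symmetry; apply E, Hxy.
  - apply (smooth_on_ext U fy); auto; intros x y Hxy; symmetry; apply E, Hxy.
  - intros x y Hxy; rewrite (proj1 (E x y Hxy)), (proj2 (E x y Hxy)); auto.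
Qed.

Lemma smooth_on_dx (U : R -> R -> Prop) (f : R -> R -> R) :
  open_plane U -> smooth_on U f -> smooth_on U (dx f).
Proof. intros HU Hf; apply (smooth_on_derivatives U f HU Hf). Qed.

Lemma smooth_on_dy (U : R -> R -> Prop) (f : R -> R -> R) :
  open_plane U -> smooth_on U f -> smooth_on U (dy f).
Proof. intros HU Hf; apply (smooth_on_derivatives U f HU Hf). Qed.

Lemma smooth_on_differentiable (U : R -> R -> Prop) (f : R -> R -> R) (x y : R) :
  open_plane U -> smooth_on U f -> U x y ->
  differentiable_pt_lim f x y (dx f x y) (dy f x y).
Proof. intros HU Hf; apply (smooth_on_derivatives U f HU Hf). Qed.

Lemma smooth_on_continuous (U : R -> R -> Prop) (f : R -> R -> R) (x y : R) :
  open_plane U -> smooth_on U f -> U x y -> continuity_2d_pt f x y.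
Proof.
  intros HU Hf Hxy; apply differentiable_continuity_pt.
  eexists; eexists; apply (smooth_on_differentiable U); assumption.
Qed.

Lemma differentiable_pt_lim_is_derive (f : R -> R -> R) (x y lx ly : R) :
  differentiable_pt_lim f x y lx ly ->
  is_derive (fun t => f t y) x lx /\ is_derive (fun t => f x t) y ly.
Proof.
  intros D; split; apply is_derive_Reals.
  - replace lx with (lx * 1 + ly * 0) by ring.
    apply (derivable_pt_lim_comp_2d f (fun t => t) (fun _ => y)); auto.
    + apply derivable_pt_lim_id.
    + apply derivable_pt_lim_const.
  - replace ly with (lx * 0 + ly * 1) by ring.
    apply (derivable_pt_lim_comp_2d f (fun _ => x) (fun t => t)); auto.
    + apply derivable_pt_lim_const.
    + apply derivable_pt_lim_id.
Qed.

Lemma smooth_on_is_derive (U : R -> R -> Prop) (f : R -> R -> R) (x y : R) :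
  open_plane U -> smooth_on U f -> U x y ->
  is_derive (fun t => f t y) x (dx f x y) /\ is_derive (fun t => f x t) y (dy f x y).
Proof.
  intros HU Hf Hxy; apply differentiable_pt_lim_is_derive.
  apply (smooth_on_differentiable U); assumption.
Qed.

(** Joint differentiability from one continuous partial derivative near the
    point and the mere existence of the other one at the point. *)
Lemma differentiable_of_continuous_partial (f fx : R -> R -> R) (x y ly : R) :
  locally_2d (fun u v => is_derive (fun t => f t v) u (fx u v)) x y ->
  is_derive (fun t => f x t) y ly ->
  continuity_2d_pt fx x y ->
  differentiable_pt_lim f x y (fx x y) ly.
Proof.
  intros Hx Hy Hc; apply filterdiff_differentiable_pt_lim.
  apply (is_derive_filterdiff f x y fx ly).
  - apply locally_2d_locally in Hx; exact Hx.
  - exact Hy.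
  - apply continuity_2d_pt_filterlim in Hc; exact Hc.
Qed.

Lemma smooth_on_ex_diff_n (U : R -> R -> Prop) (f : R -> R -> R) (n : nat) (x y : R) :
  open_plane U -> smooth_on U f -> U x y -> ex_diff_n f n x y.
Proof.
  intros HU; revert f; induction n as [|n IH]; intros f Hf Hxy.
  - split; [apply (smooth_on_continuous U); assumption|exact I].
  - destruct (smooth_on_is_derive U f x y HU Hf Hxy) as [D1 D2].
    split; [apply (smooth_on_continuous U); assumption|].
    split; [eexists; exact D1|split; [eexists; exact D2|]].
    split; [apply (IH (dx f))|apply (IH (dy f))]; try assumption.
    + apply smooth_on_dx; assumption.
    + apply smooth_on_dy; assumption.
Qed.

(** Functions that are C^n on U for every n form a stable family: membership of
    the partial derivatives is built into [ex_diff_n], and continuity of one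
    partial derivative yields joint differentiability. *)
Lemma ex_diff_n_smooth_on (U : R -> R -> Prop) (f : R -> R -> R) :
  open_plane U -> (forall x y n, U x y -> ex_diff_n f n x y) -> smooth_on U f.
Proof.
  intros HU Hf.
  exists (fun g => forall x y n, U x y -> ex_diff_n g n x y); split; [|exact Hf].
  clear f Hf; intros f Hf; exists (dx f), (dy f); split; [|split].
  - intros x y n Hxy; apply (Hf x y (S n) Hxy).
  - intros x y n Hxy; apply (Hf x y (S n) Hxy).
  - intros x y Hxy; apply differentiable_of_continuous_partial.
    + destruct (HU x y Hxy) as [d Hd]; exists d; intros u v Hu Hv.
      apply Derive_correct, (Hf u v 1%nat (Hd u v Hu Hv)).
    + apply Derive_correct, (Hf x y 1%nat Hxy).
    + apply (Hf x y 1%nat Hxy).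
Qed.

Lemma smooth_germ_iff (f : R -> R -> R) :
  smooth_germ f <-> exists d : posreal, smooth_on (box d) f.
Proof.
  split.
  - intros [d Hd]; exists d; apply ex_diff_n_smooth_on; [apply box_open|].
    intros x y n [Hx Hy]; apply Hd; rewrite Rminus_0_r; assumption.
  - intros [d Hd]; exists d; intros u v Hu Hv n; rewrite Rminus_0_r in Hu, Hv.
    apply (smooth_on_ex_diff_n (box d)); [apply box_open|exact Hd|split; assumption].
Qed.

(** * Weighted means along rays *)

Lemma open_preimage (U : R -> R -> Prop) (u v : R -> R -> R) :
  open_plane U ->
  (forall x y, continuity_2d_pt u x y) -> (forall x y, continuity_2d_pt v x y) ->
  open_plane (fun x y => U (u x y) (v x y)).
Proof.
  intros HU Hu Hv x y Hxy; destruct (HU _ _ Hxy) as [e He].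
  generalize (locally_2d_and _ _ x y (Hu x y e) (Hv x y e)).
  apply locally_2d_impl, locally_2d_forall; intros a b [H1 H2]; auto.
Qed.

(** With w(t) = (1 - t)^n these are the integrals of Taylor's remainder. *)
Definition ray_mean (w : R -> R) (g : R -> R -> R) (x y : R) : R :=
  RInt (fun t => w t * g (t * x) (t * y)) 0 1.

(** The bound by 1 makes the means inherit moduli of continuity. Weights are
    closed under multiplication by t, which is what differentiating under the
    integral sign produces. *)
Definition weight (w : R -> R) : Prop :=
  (forall U, open_plane U -> smooth_on U (fun _ t => w t)) /\
  (forall t, 0 <= t <= 1 -> Rabs (w t) <= 1).

Lemma weight_const : weight (fun _ => 1).
Proof.
  split; [intros; apply smooth_on_const|intros; rewrite Rabs_R1; lra].
Qed.

Lemma weight_id : weight (fun t => t).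
Proof.
  split; [exact smooth_on_snd|].
  intros t Ht; rewrite Rabs_pos_eq; lra.
Qed.

Lemma weight_mult (v w : R -> R) : weight v -> weight w -> weight (fun t => v t * w t).
Proof.
  intros [V1 V2] [W1 W2]; split.
  - intros U HU; apply smooth_on_mult; auto.
  - intros t Ht; rewrite Rabs_mult; specialize (V2 t Ht); specialize (W2 t Ht).
    replace 1 with (1 * 1) by ring; apply Rmult_le_compat; auto using Rabs_pos.
Qed.

Lemma weight_pow (n : nat) : weight (fun t => (1 - t) ^ n).
Proof.
  induction n as [|n IH]; [exact weight_const|].
  apply (weight_mult (fun t => 1 - t)); [|exact IH]; split.
  - intros U HU; apply smooth_on_minus; auto using smooth_on_const, smooth_on_snd.
  - intros t Ht; rewrite Rabs_pos_eq; lra.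
Qed.

Lemma box_shrink (d t x y : R) : 0 <= t <= 1 -> box d x y -> box d (t * x) (t * y).
Proof.
  intros Ht [Hx Hy]; pose proof (Rabs_pos x); pose proof (Rabs_pos y).
  split; rewrite Rabs_mult, (Rabs_pos_eq t); nra.
Qed.

Section RayMean.

Variables (d : R) (w : R -> R) (g : R -> R -> R).
Hypotheses (Hw : weight w) (Hg : smooth_on (box d) g).

Lemma ray_is_derive (t x y : R) : box d (t * x) (t * y) ->
  is_derive (fun s => g (s * x) (s * y)) t
    (x * dx g (t * x) (t * y) + y * dy g (t * x) (t * y)).
Proof.
  intros H; apply is_derive_Reals.
  pose proof (smooth_on_differentiable _ _ _ _ (box_open d) Hg H) as D.
  replace (_ + _) with (dx g (t * x) (t * y) * x + dy g (t * x) (t * y) * y) by ring.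
  apply (derivable_pt_lim_comp_2d g (fun s => s * x) (fun s => s * y) t _ _ x y D).
  - apply is_derive_Reals; auto_derive; [exact I|ring].
  - apply is_derive_Reals; auto_derive; [exact I|ring].
Qed.

(** For fixed v, the integrand is a smooth function of (u, t) on this open set,
    which contains [0, 1] in the t-direction and a margin around it. *)
Definition ray_domain (v u t : R) : Prop := box d (t * u) (t * v).

Lemma ray_domain_open (v : R) : open_plane (ray_domain v).
Proof.
  apply (open_preimage (box d) (fun u t => t * u) (fun u t => t * v)).
  - apply box_open.
  - intros; apply continuity_2d_pt_mult;
      auto using continuity_2d_pt_id1, continuity_2d_pt_id2.
  - intros; apply continuity_2d_pt_mult;
      auto using continuity_2d_pt_const, continuity_2d_pt_id2.
Qed.

Lemma ray_integrand_smooth (v : R) :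
  smooth_on (ray_domain v) (fun u t => w t * g (t * u) (t * v)).
Proof.
  pose proof (ray_domain_open v) as HO.
  apply smooth_on_mult; [apply Hw, HO|].
  apply (smooth_on_comp _ (box d)); auto.
  - apply smooth_on_mult; auto using smooth_on_fst, smooth_on_snd.
  - apply smooth_on_mult; auto using smooth_on_const, smooth_on_snd.
Qed.

Lemma ray_continuous (t x y : R) : 0 <= t <= 1 -> box d x y ->
  continuous (fun s => w s * g (s * x) (s * y)) t.
Proof.
  intros Ht Hxy; apply (ex_derive_continuous (fun s => w s * g (s * x) (s * y))).
  eexists; apply (smooth_on_is_derive _ _ x t (ray_domain_open y)
    (ray_integrand_smooth y)).
  apply box_shrink; assumption.
Qed.

Lemma ray_integrable (x y : R) : box d x y ->
  ex_RInt (fun t => w t * g (t * x) (t * y)) 0 1.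
Proof.
  intros Hxy; apply (@ex_RInt_continuous R_CompleteNormedModule).
  rewrite Rmin_left, Rmax_right by lra; intros t Ht; apply ray_continuous; assumption.
Qed.

(** Uniform continuity of g on a closed square between (x, y) and the boundary
    of the box bounds the difference of the integrands uniformly in t. *)
Lemma ray_mean_continuous (x y : R) : box d x y ->
  continuity_2d_pt (ray_mean w g) x y.
Proof.
  intros Hxy eps.
  set (m := Rmax (Rabs x) (Rabs y)).
  set (r := (m + d) / 2).
  assert (Hm : Rabs x <= m /\ Rabs y <= m /\ m < d).
  { destruct Hxy; repeat split; [apply Rmax_l|apply Rmax_r|apply Rmax_lub_lt; auto]. }
  assert (Hr : m < r < d) by (unfold r; lra).
  assert (H0 : 0 <= m) by (pose proof (Rabs_pos x); lra).
  assert (He : 0 < eps / 2) by (pose proof (cond_pos eps); lra).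
  destruct (uniform_continuity_2d g (- r) r (- r) r) with (eps := mkposreal _ He)
    as [e Hu].
  { intros a b Ha Hb; apply (smooth_on_continuous (box d)); auto using box_open.
    split; apply Rabs_def1; lra. }
  simpl in Hu.
  assert (Hd : 0 < Rmin e (r - m)) by (apply Rmin_pos; [apply cond_pos|lra]).
  exists (mkposreal _ Hd); simpl; intros u v Hux Hvy.
  pose proof (Rmin_l e (r - m)); pose proof (Rmin_r e (r - m)).
  assert (Hur : Rabs u <= r).
  { pose proof (Rabs_triang (u - x) x) as T.
    replace (u - x + x) with u in T by ring; lra. }
  assert (Hvr : Rabs v <= r).
  { pose proof (Rabs_triang (v - y) y) as T.
    replace (v - y + y) with v in T by ring; lra. }
  assert (Huv : box d u v) by (split; lra).
  assert (Hin : forall t a, 0 <= t <= 1 -> Rabs a <= r -> - r <= t * a <= r).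
  { intros t a Ht Ha; apply Rabs_le_between; rewrite Rabs_mult, (Rabs_pos_eq t) by lra.
    pose proof (Rabs_pos a); nra. }
  assert (Hlt : forall t a b, 0 <= t <= 1 -> Rabs (a - b) < e -> Rabs (t * a - t * b) < e).
  { intros t a b Ht Ha; rewrite <- Rmult_minus_distr_l, Rabs_mult, (Rabs_pos_eq t) by lra.
    pose proof (Rabs_pos (a - b)); nra. }
  unfold ray_mean.
  rewrite <- (RInt_minus (V := R_CompleteNormedModule)) by (apply ray_integrable; auto).
  apply Rle_lt_trans with ((1 - 0) * (eps / 2)); [|lra].
  apply abs_RInt_le_const; [lra| |].
  - apply (ex_RInt_minus (V := R_NormedModule)); apply ray_integrable; auto.
  - intros t Ht; unfold minus, plus, opp; simpl.
    replace (_ + _) with (w t * (g (t * u) (t * v) - g (t * x) (t * y))) by ring.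
    rewrite Rabs_mult, <- (Rmult_1_l (eps / 2)).
    apply Rmult_le_compat; auto using Rabs_pos; [apply Hw, Ht|].
    left; apply Hu; try (apply Hin; [exact Ht|lra]); apply Hlt; auto; lra.
Qed.

Lemma ray_mean_is_derive (x y : R) : box d x y ->
  is_derive (fun u => ray_mean w g u y) x (ray_mean (fun t => t * w t) (dx g) x y).
Proof.
  intros Hxy.
  pose proof (ray_domain_open y) as HO; pose proof (ray_integrand_smooth y) as HS.
  assert (Hloc : locally x (fun u => box d u y)).
  { apply locally_2d_1d_const_y with (P := box d), box_open, Hxy. }
  evar_last.
  - apply (is_derive_RInt_param (fun u t => w t * g (t * u) (t * y)) 0 1 x).
    + revert Hloc; apply filter_imp; intros u Hu t Ht.
      rewrite Rmin_left, Rmax_right in Ht by lra.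
      eexists; apply (smooth_on_is_derive _ _ u t HO HS).
      apply box_shrink; assumption.
    + intros t Ht; rewrite Rmin_left, Rmax_right in Ht by lra.
      apply (smooth_on_continuous (ray_domain y) (dx (fun u t => w t * g (t * u) (t * y)))).
      * exact HO.
      * apply smooth_on_dx; assumption.
      * apply box_shrink; assumption.
    + revert Hloc; apply filter_imp; intros u Hu; apply ray_integrable, Hu.
  - apply RInt_ext; rewrite Rmin_left, Rmax_right by lra; intros t Ht.
    apply is_derive_unique.
    assert (Hb : box d (t * x) (t * y)) by (apply box_shrink; auto; lra).
    apply is_derive_ext with (fun u => w t * g (t * u) (t * y)); [reflexivity|].
    replace (t * w t * dx g (t * x) (t * y))
      with (w t * (t * dx g (t * x) (t * y))) by ring.
    apply is_derive_scal.
    apply (is_derive_comp (fun a => g a (t * y)) (fun u => t * u)).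
    + apply (smooth_on_is_derive (box d)); auto using box_open.
    + auto_derive; [exact I|ring].
Qed.

End RayMean.

Lemma ray_mean_differentiable (d : R) (w : R -> R) (g : R -> R -> R) (x y : R) :
  weight w -> smooth_on (box d) g -> box d x y ->
  differentiable_pt_lim (ray_mean w g) x y
    (ray_mean (fun t => t * w t) (dx g) x y) (ray_mean (fun t => t * w t) (dy g) x y).
Proof.
  intros Hw Hg Hxy.
  apply differentiable_of_continuous_partial.
  - destruct (box_open d x y Hxy) as [e He]; exists e; intros u v Hu Hv.
    apply (ray_mean_is_derive d); auto.
  - apply (ray_mean_is_derive d w (fun a b => g b a)); auto.
    + apply (smooth_on_comp _ (box d)); auto.
      * intros a b [Ha Hb]; split; assumption.
      * apply smooth_on_snd, box_open.
      * apply smooth_on_fst, box_open.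
    + destruct Hxy; split; assumption.
  - apply (ray_mean_continuous d); auto using weight_mult, weight_id.
    apply smooth_on_dx; auto using box_open.
Qed.

(** The means of smooth functions against arbitrary weights form a stable
    family. *)
Lemma ray_mean_smooth (d : R) (w : R -> R) (g : R -> R -> R) :
  weight w -> smooth_on (box d) g -> smooth_on (box d) (ray_mean w g).
Proof.
  intros Hw Hg.
  exists (fun f => exists v h, weight v /\ smooth_on (box d) h /\ f = ray_mean v h).
  split; [|exists w, g; auto].
  intros f [v [h [Hv [Hh ->]]]].
  exists (ray_mean (fun t => t * v t) (dx h)), (ray_mean (fun t => t * v t) (dy h)).
  split; [|split].
  - exists (fun t => t * v t), (dx h).
    split; [|split]; auto using weight_mult, weight_id, smooth_on_dx, box_open.
  - exists (fun t => t * v t), (dy h).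
    split; [|split]; auto using weight_mult, weight_id, smooth_on_dy, box_open.
  - intros x y; apply ray_mean_differentiable; assumption.
Qed.

(** For a derivative g of order n of f, this is, up to the factor (n - 1)!, the
    coefficient that replaces g(0, 0) in the remainder of Taylor's formula of f;
    in order 0 the remainder is f itself. *)
Definition remainder (n : nat) (g : R -> R -> R) : R -> R -> R :=
  match n with
  | O => g
  | S m => ray_mean (fun t => (1 - t) ^ m) g
  end.

Lemma remainder_smooth (d : R) (n : nat) (g : R -> R -> R) :
  smooth_on (box d) g -> smooth_on (box d) (remainder n g).
Proof.
  destruct n as [|n]; simpl; [auto|].
  intros Hg; apply ray_mean_smooth; auto using weight_pow.
Qed.

(** The fundamental theorem of calculus for t |-> - (1 - t)^m g(tx, ty) on
    [0, 1]. At m = 0 the term 0^m is 1, and the statement is the usual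
    g(x, y) - g(0, 0) formula. *)
Lemma ray_integration_by_parts (d : R) (m : nat) (g : R -> R -> R) (x y : R) :
  smooth_on (box d) g -> box d x y ->
  is_RInt (fun t => INR m * (1 - t) ^ pred m * g (t * x) (t * y)) 0 1
    (g 0 0 - 0 ^ m * g x y
     + (x * remainder (S m) (dx g) x y + y * remainder (S m) (dy g) x y)).
Proof.
  intros Hg Hxy; simpl remainder.
  assert (Ix := RInt_correct _ _ _ (ray_integrable d _ _ (weight_pow m)
    (smooth_on_dx _ _ (box_open d) Hg) x y Hxy)).
  assert (Iy := RInt_correct _ _ _ (ray_integrable d _ _ (weight_pow m)
    (smooth_on_dy _ _ (box_open d) Hg) x y Hxy)).
  set (F := fun t => - (1 - t) ^ m * g (t * x) (t * y)).
  set (F' := fun t => INR m * (1 - t) ^ pred m * g (t * x) (t * y)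
    - (1 - t) ^ m * (x * dx g (t * x) (t * y) + y * dy g (t * x) (t * y))).
  assert (HF : forall t, 0 <= t <= 1 -> is_derive F t (F' t)).
  { intros t Ht; unfold F, F'.
    replace (_ - _) with (INR m * (1 - t) ^ pred m * g (t * x) (t * y) + - (1 - t) ^ m *
      (x * dx g (t * x) (t * y) + y * dy g (t * x) (t * y))) by ring.
    apply is_derive_Reals, (derivable_pt_lim_mult (fun s => - (1 - s) ^ m)
      (fun s => g (s * x) (s * y)));
      apply is_derive_Reals.
    - auto_derive; [exact I|]; fold (1 - t); ring.
    - apply (ray_is_derive d g Hg), box_shrink; assumption. }
  assert (IF : is_RInt F' 0 1 (F 1 - F 0)).
  { apply (is_RInt_derive F F'); rewrite Rmin_left, Rmax_right by lra; auto.
    intros t Ht.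
    apply (continuous_ext (fun t => minus (scal (INR m) ((1 - t) ^ pred m * g (t * x) (t * y)))
      (plus (scal x ((1 - t) ^ m * dx g (t * x) (t * y)))
            (scal y ((1 - t) ^ m * dy g (t * x) (t * y)))))).
    { intros s; unfold F', minus, plus, opp, scal; simpl; unfold mult; simpl; ring. }
    apply (continuous_minus (V := R_NormedModule));
      [|apply (continuous_plus (V := R_NormedModule))];
      apply (continuous_scal_r (V := R_NormedModule)).
    - apply (ray_continuous d (fun t => (1 - t) ^ pred m)); auto using weight_pow.
    - apply (ray_continuous d (fun t => (1 - t) ^ m));
        auto using weight_pow, smooth_on_dx, box_open.
    - apply (ray_continuous d (fun t => (1 - t) ^ m));
        auto using weight_pow, smooth_on_dy, box_open. }
  replace (g 0 0 - 0 ^ m * g x y) with (F 1 - F 0).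
  2: { unfold F; rewrite !Rmult_1_l, !Rmult_0_l, Rminus_0_r, pow1.
       replace (1 - 1) with 0 by ring; ring. }
  generalize (is_RInt_plus _ _ _ _ _ _ IF (is_RInt_plus _ _ _ _ _ _
    (is_RInt_scal _ _ _ x _ Ix) (is_RInt_scal _ _ _ y _ Iy))).
  apply is_RInt_ext; intros t _; unfold F', plus, scal; simpl; unfold mult; simpl; ring.
Qed.

(** One step of Taylor's formula along the ray; the constant is 1 for n = 0 and
    1/n otherwise. *)
Lemma remainder_step (n : nat) : exists c : R,
  forall (d : R) (g : R -> R -> R) (x y : R), smooth_on (box d) g -> box d x y ->
  remainder n g x y = c * (g 0 0 + x * remainder (S n) (dx g) x y
                                 + y * remainder (S n) (dy g) x y).
Proof.
  destruct n as [|n].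
  - exists 1; intros d g x y Hg Hxy.
    assert (H := is_RInt_unique _ _ _ _ (ray_integration_by_parts d 0 g x y Hg Hxy)).
    rewrite (RInt_ext _ (fun _ => 0)), RInt_const in H by (intros; simpl; ring).
    unfold scal in H; simpl in H; unfold mult in H; simpl in H; simpl; lra.
  - exists (/ INR (S n)); intros d g x y Hg Hxy.
    assert (Hn : INR (S n) <> 0) by (apply not_0_INR; discriminate).
    apply (Rmult_eq_reg_l (INR (S n))); [|exact Hn].
    rewrite <- Rmult_assoc, Rinv_r, Rmult_1_l by exact Hn.
    assert (H := is_RInt_unique _ _ _ _ (ray_integration_by_parts d (S n) g x y Hg Hxy)).
    rewrite pow_i, Rmult_0_l, Rminus_0_r, <- Rplus_assoc in H by lia.
    rewrite <- H; simpl remainder; unfold ray_mean.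
    rewrite <- (RInt_scal (V := R_CompleteNormedModule)).
    + apply RInt_ext; intros t _; unfold scal; simpl; unfold mult; simpl; ring.
    + apply (ray_integrable d); auto using weight_pow.
Qed.

(** * Perturbations of the identity are diffeomorphism germs *)

(** The mean value theorem along the two sides of an axis-parallel path, which
    stays inside the box. *)
Lemma box_lipschitz (d k : R) (f : R -> R -> R) :
  smooth_on (box d) f ->
  (forall x y, box d x y -> Rabs (dx f x y) <= k /\ Rabs (dy f x y) <= k) ->
  forall x y u v, box d x y -> box d u v ->
  Rabs (f x y - f u v) <= k * (Rabs (x - u) + Rabs (y - v)).
Proof.
  intros Hf Hk x y u v [Hx Hy] [Hu Hv].
  assert (Hseg : forall s t c, Rabs s < d -> Rabs t < d ->
    Rmin s t <= c <= Rmax s t -> Rabs c < d).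
  { intros s t c Hs Ht Hc; apply Rabs_lt_between in Hs, Ht; apply Rabs_lt_between.
    unfold Rmin, Rmax in Hc; destruct (Rle_dec s t); lra. }
  assert (HD : forall a b, Rabs a < d -> Rabs b < d ->
    is_derive (fun t => f t b) a (dx f a b) /\ is_derive (fun t => f a t) b (dy f a b)).
  { intros a b Ha Hb; apply (smooth_on_is_derive (box d)); auto using box_open.
    split; assumption. }
  destruct (MVT_gen (fun t => f t y) u x (fun t => dx f t y)) as [c1 [Hc1 E1]].
  { intros a Ha; apply HD; [apply (Hseg u x); lra|assumption]. }
  { intros a Ha; apply derivable_continuous_pt; exists (dx f a y); apply is_derive_Reals.
    exact (proj1 (HD a y (Hseg u x a Hu Hx Ha) Hy)). }
  destruct (MVT_gen (fun t => f u t) v y (fun t => dy f u t)) as [c2 [Hc2 E2]].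
  { intros a Ha; apply HD; [assumption|apply (Hseg v y); lra]. }
  { intros a Ha; apply derivable_continuous_pt; exists (dy f u a); apply is_derive_Reals.
    exact (proj2 (HD u a Hu (Hseg v y a Hv Hy Ha))). }
  replace (f x y - f u v) with (dx f c1 y * (x - u) + dy f u c2 * (y - v)) by lra.
  apply Rle_trans with (1 := Rabs_triang _ _); rewrite !Rabs_mult, Rmult_plus_distr_l.
  apply Rplus_le_compat; apply Rmult_le_compat_r; auto using Rabs_pos; apply Hk;
    split; eauto.
Qed.

Lemma geometric_increments_converge (u : nat -> R) (M : R) :
  (forall n, Rabs (u (S n) - u n) <= M * (1 / 2) ^ n) -> ex_finite_lim_seq u.
Proof.
  intros Hu.
  assert (HS : ex_series (fun n => u (S n) - u n)).
  { apply (@ex_series_le R_AbsRing R_CompleteNormedModule _ (fun n => M * (1 / 2) ^ n)).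
    - exact Hu.
    - apply (ex_series_scal_l M (fun n => (1 / 2) ^ n)), ex_series_geom.
      rewrite Rabs_pos_eq; lra. }
  destruct HS as [l Hl].
  exists (l + u 0%nat); apply is_lim_seq_incr_1.
  apply is_lim_seq_ext with (fun n => sum_n (fun n => u (S n) - u n) n + u 0%nat).
  - intros n; induction n as [|n IH]; [rewrite sum_O; ring|].
    rewrite sum_Sn, <- IH; unfold plus; simpl; ring.
  - apply (is_lim_seq_plus' _ (fun _ => u 0%nat)); [exact Hl|apply is_lim_seq_const].
Qed.

Section LocalInverse.

Variables (d : R) (e1 e2 : R -> R -> R).
Hypotheses (Hd : 0 < d)
  (S1 : smooth_on (box d) e1) (S2 : smooth_on (box d) e2)
  (Z1 : e1 0 0 = 0) (Z2 : e2 0 0 = 0)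
  (B1 : forall x y, box d x y -> Rabs (dx e1 x y) <= / 4 /\ Rabs (dy e1 x y) <= / 4)
  (B2 : forall x y, box d x y -> Rabs (dx e2 x y) <= / 4 /\ Rabs (dy e2 x y) <= / 4).

(** Measured in the sum norm, the perturbation e = (e1, e2) is a contraction of
    ratio 1/2 (each of the two components contributes 1/4), so that the
    equation p + e(p) = (a, b) can be solved by iterating p |-> (a, b) - e(p). *)
Lemma perturbation_contracts (x y u v : R) : box d x y -> box d u v ->
  Rabs (e1 x y - e1 u v) + Rabs (e2 x y - e2 u v)
    <= (Rabs (x - u) + Rabs (y - v)) / 2.
Proof.
  intros H H'.
  pose proof (box_lipschitz d _ e1 S1 B1 x y u v H H').
  pose proof (box_lipschitz d _ e2 S2 B2 x y u v H H'); lra.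
Qed.

Fixpoint picard (a b : R) (n : nat) : R * R :=
  match n with
  | O => (0, 0)
  | S m => let p := picard a b m in
           (a - e1 (fst p) (snd p), b - e2 (fst p) (snd p))
  end.

Lemma box_of_sum (x y : R) : Rabs x + Rabs y < d -> box d x y.
Proof. pose proof (Rabs_pos x); pose proof (Rabs_pos y); split; lra. Qed.

Lemma picard_bound (a b : R) (n : nat) : Rabs a + Rabs b < d / 2 ->
  Rabs (fst (picard a b n)) + Rabs (snd (picard a b n)) <= 2 * (Rabs a + Rabs b).
Proof.
  intros Hab; pose proof (Rabs_pos a); pose proof (Rabs_pos b).
  induction n as [|n IH]; simpl; [rewrite Rabs_R0; lra|].
  set (x := fst (picard a b n)) in *; set (y := snd (picard a b n)) in *.
  assert (C := perturbation_contracts x y 0 0 (box_of_sum x y ltac:(lra))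
    (box_of_sum 0 0 ltac:(rewrite Rabs_R0; lra))).
  rewrite Z1, Z2, !Rminus_0_r in C.
  pose proof (Rabs_triang a (- e1 x y)) as T1; rewrite Rabs_Ropp in T1.
  pose proof (Rabs_triang b (- e2 x y)) as T2; rewrite Rabs_Ropp in T2.
  unfold Rminus; lra.
Qed.

Lemma picard_increment (a b : R) (n : nat) : Rabs a + Rabs b < d / 2 ->
  Rabs (fst (picard a b (S n)) - fst (picard a b n))
    + Rabs (snd (picard a b (S n)) - snd (picard a b n))
    <= (Rabs a + Rabs b) * (1 / 2) ^ n.
Proof.
  intros Hab; induction n as [|n IH].
  - simpl; rewrite Z1, Z2, !Rminus_0_r; lra.
  - assert (Hb : forall m, box d (fst (picard a b m)) (snd (picard a b m))).
    { intros m; apply box_of_sum; pose proof (picard_bound a b m Hab); lra. }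
    assert (C := perturbation_contracts _ _ _ _ (Hb n) (Hb (S n))).
    rewrite (Rabs_minus_sym (fst (picard a b n))), (Rabs_minus_sym (snd (picard a b n))) in C.
    change (fst (picard a b (S (S n)))) with
      (a - e1 (fst (picard a b (S n))) (snd (picard a b (S n)))).
    change (snd (picard a b (S (S n)))) with
      (b - e2 (fst (picard a b (S n))) (snd (picard a b (S n)))).
    change (fst (picard a b (S n))) with
      (a - e1 (fst (picard a b n)) (snd (picard a b n))) at 2.
    change (snd (picard a b (S n))) with
      (b - e2 (fst (picard a b n)) (snd (picard a b n))) at 3.
    replace (a - _ - _) with (e1 (fst (picard a b n)) (snd (picard a b n)) -
      e1 (fst (picard a b (S n))) (snd (picard a b (S n)))) by ring.
    replace (b - _ - _) with (e2 (fst (picard a b n)) (snd (picard a b n)) -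
      e2 (fst (picard a b (S n))) (snd (picard a b (S n)))) by ring.
    replace ((1 / 2) ^ S n) with ((1 / 2) ^ n / 2) by (simpl; field).
    lra.
Qed.

(** Taking the limit of the iterates gives the local inverse as an explicit
    function, without any choice of a solution. *)
Definition inv1 (a b : R) : R := real (Lim_seq (fun n => fst (picard a b n))).
Definition inv2 (a b : R) : R := real (Lim_seq (fun n => snd (picard a b n))).

Lemma picard_limit (a b : R) : Rabs a + Rabs b < d / 2 ->
  is_lim_seq (fun n => fst (picard a b n)) (inv1 a b) /\
  is_lim_seq (fun n => snd (picard a b n)) (inv2 a b).
Proof.
  intros Hab.
  split; apply Lim_seq_correct', (geometric_increments_converge _ (Rabs a + Rabs b));
    intros n; apply Rle_trans with (2 := picard_increment a b n Hab).
  - pose proof (Rabs_pos (snd (picard a b (S n)) - snd (picard a b n))); lra.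
  - pose proof (Rabs_pos (fst (picard a b (S n)) - fst (picard a b n))); lra.
Qed.

Lemma inv_bound (a b : R) : Rabs a + Rabs b < d / 2 ->
  Rabs (inv1 a b) + Rabs (inv2 a b) <= 2 * (Rabs a + Rabs b).
Proof.
  intros Hab; destruct (picard_limit a b Hab) as [L1 L2].
  apply (is_lim_seq_le
    (fun n => Rabs (fst (picard a b n)) + Rabs (snd (picard a b n)))
    (fun _ => 2 * (Rabs a + Rabs b)) (Rabs (inv1 a b) + Rabs (inv2 a b))
    (2 * (Rabs a + Rabs b))).
  - intros n; apply picard_bound, Hab.
  - apply is_lim_seq_plus'; [apply (is_lim_seq_abs _ _ L1)|apply (is_lim_seq_abs _ _ L2)].
  - apply is_lim_seq_const.
Qed.

Lemma inv_box (a b : R) : Rabs a + Rabs b < d / 2 -> box d (inv1 a b) (inv2 a b).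
Proof. intros Hab; apply box_of_sum; pose proof (inv_bound a b Hab); lra. Qed.

Lemma inv_correct (a b : R) : Rabs a + Rabs b < d / 2 ->
  inv1 a b + e1 (inv1 a b) (inv2 a b) = a /\ inv2 a b + e2 (inv1 a b) (inv2 a b) = b.
Proof.
  intros Hab; destruct (picard_limit a b Hab) as [L1 L2].
  set (x := inv1 a b) in *; set (y := inv2 a b) in *.
  assert (Hlim : is_lim_seq (fun n => (Rabs (fst (picard a b n) - x)
    + Rabs (snd (picard a b n) - y)) / 2) 0).
  { replace 0 with ((Rabs (x - x) + Rabs (y - y)) * / 2)
      by (rewrite !Rminus_diag, Rabs_R0; field).
    apply (is_lim_seq_scal_r _ (/ 2) (Finite _)).
    apply is_lim_seq_plus'.
    - apply (is_lim_seq_abs _ (Finite _)), is_lim_seq_minus'; [exact L1|apply is_lim_seq_const].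
    - apply (is_lim_seq_abs _ (Finite _)), is_lim_seq_minus'; [exact L2|apply is_lim_seq_const]. }
  assert (HC : forall n,
    Rabs (e1 (fst (picard a b n)) (snd (picard a b n)) - e1 x y)
    + Rabs (e2 (fst (picard a b n)) (snd (picard a b n)) - e2 x y)
    <= (Rabs (fst (picard a b n) - x) + Rabs (snd (picard a b n) - y)) / 2).
  { intros n; apply perturbation_contracts; [|apply inv_box, Hab].
    apply box_of_sum; pose proof (picard_bound a b n Hab); lra. }
  assert (Hsq : forall (v : nat -> R) (l : R), (forall n, Rabs (v n - l) <=
      (Rabs (fst (picard a b n) - x) + Rabs (snd (picard a b n) - y)) / 2) ->
      is_lim_seq v l).
  { intros v l Hv.
    apply is_lim_seq_ext with (fun n => (v n - l) + l); [intros; ring|].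
    replace (Finite l) with (Finite (0 + l)) by (f_equal; ring).
    apply is_lim_seq_plus'; [|apply is_lim_seq_const].
    apply is_lim_seq_abs_0.
    apply is_lim_seq_le_le with (fun _ => 0) (fun n => (Rabs (fst (picard a b n) - x)
      + Rabs (snd (picard a b n) - y)) / 2); auto using is_lim_seq_const.
    intros n; split; [apply Rabs_pos|apply Hv]. }
  assert (M1 : is_lim_seq (fun n => e1 (fst (picard a b n)) (snd (picard a b n))) (e1 x y)).
  { apply Hsq; intros n; specialize (HC n).
    pose proof (Rabs_pos (e2 (fst (picard a b n)) (snd (picard a b n)) - e2 x y)); lra. }
  assert (M2 : is_lim_seq (fun n => e2 (fst (picard a b n)) (snd (picard a b n))) (e2 x y)).
  { apply Hsq; intros n; specialize (HC n).
    pose proof (Rabs_pos (e1 (fst (picard a b n)) (snd (picard a b n)) - e1 x y)); lra. }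
  apply is_lim_seq_incr_1 in L1; apply is_lim_seq_incr_1 in L2.
  pose proof (is_lim_seq_minus' _ _ _ _ (is_lim_seq_const a) M1) as N1.
  pose proof (is_lim_seq_minus' _ _ _ _ (is_lim_seq_const b) M2) as N2.
  apply is_lim_seq_unique in L1, L2, N1, N2; simpl in L1, L2.
  rewrite N1 in L1; rewrite N2 in L2.
  injection L1; injection L2; lra.
Qed.

(** The inverse is 2-Lipschitz; in particular it is unique on the box. *)
Lemma perturbation_injective (x y u v : R) : box d x y -> box d u v ->
  Rabs (x - u) + Rabs (y - v) <=
  2 * (Rabs ((x + e1 x y) - (u + e1 u v)) + Rabs ((y + e2 x y) - (v + e2 u v))).
Proof.
  intros H H'; assert (C := perturbation_contracts x y u v H H').
  pose proof (Rabs_triang ((x + e1 x y) - (u + e1 u v)) (- (e1 x y - e1 u v))) as T1.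
  pose proof (Rabs_triang ((y + e2 x y) - (v + e2 u v)) (- (e2 x y - e2 u v))) as T2.
  rewrite Rabs_Ropp in T1, T2.
  replace (x + e1 x y - (u + e1 u v) + - (e1 x y - e1 u v)) with (x - u) in T1 by ring.
  replace (y + e2 x y - (v + e2 u v) + - (e2 x y - e2 u v)) with (y - v) in T2 by ring.
  lra.
Qed.

Definition jac (x y : R) : R :=
  (1 + dx e1 x y) * (1 + dy e2 x y) - dy e1 x y * dx e2 x y.

Lemma jac_lower (x y : R) : box d x y -> / 2 <= jac x y.
Proof.
  intros H; destruct (B1 x y H) as [A1 A2]; destruct (B2 x y H) as [A3 A4].
  unfold jac; apply Rabs_le_between in A1, A2, A3, A4; nra.
Qed.

(** The derivative of the inverse is the inverse Jacobian matrix. Its entries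
    are at most 5/2 (numerators at most 5/4, determinant at least 1/2), and
    passing from the increment of the inverse to that of its argument costs a
    factor 4 in the maximum norm. *)
Lemma inv_differentiable (a b : R) : box (d / 4) a b ->
  let x := inv1 a b in let y := inv2 a b in
  differentiable_pt_lim inv1 a b
    ((1 + dy e2 x y) * / jac x y) (- dy e1 x y * / jac x y) /\
  differentiable_pt_lim inv2 a b
    (- dx e2 x y * / jac x y) ((1 + dx e1 x y) * / jac x y).
Proof.
  intros Hab x y.
  assert (HS : forall u v, box (d / 4) u v -> Rabs u + Rabs v < d / 2)
    by (intros u v [Hu Hv]; lra).
  assert (Hxy : box d x y) by apply inv_box, HS, Hab.
  pose proof (smooth_on_differentiable _ _ _ _ (box_open d) S1 Hxy) as D1.
  pose proof (smooth_on_differentiable _ _ _ _ (box_open d) S2 Hxy) as D2.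
  destruct (B1 x y Hxy) as [A1 A2]; destruct (B2 x y Hxy) as [A3 A4].
  pose proof (jac_lower x y Hxy) as HJ.
  pose proof (inv_correct a b (HS a b Hab)) as [I1 I2]; fold x y in I1, I2.
  assert (main : forall eps : posreal, locally_2d (fun u v =>
    let M := Rmax (Rabs (u - a)) (Rabs (v - b)) in
    Rabs (inv1 u v - x - ((1 + dy e2 x y) * / jac x y * (u - a)
       + - dy e1 x y * / jac x y * (v - b))) <= eps * M /\
    Rabs (inv2 u v - y - (- dx e2 x y * / jac x y * (u - a)
       + (1 + dx e1 x y) * / jac x y * (v - b))) <= eps * M) a b).
  { intros eps.
    (* 20 = 4 * 5/2 * 2: Lipschitz factor, matrix entry, two remainders. *)
    assert (He : 0 < eps / 20) by (pose proof (cond_pos eps); lra).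
    destruct (D1 (mkposreal _ He)) as [r1 R1]; destruct (D2 (mkposreal _ He)) as [r2 R2].
    simpl in R1, R2.
    destruct (box_open _ _ _ Hab) as [r3 R3].
    pose proof (cond_pos r1) as P1; pose proof (cond_pos r2) as P2.
    assert (Hr : 0 < Rmin r3 (Rmin r1 r2 / 4)).
    { apply Rmin_pos; [apply cond_pos|].
      apply Rdiv_lt_0_compat; [apply Rmin_pos; assumption|lra]. }
    exists (mkposreal _ Hr); simpl; intros u v Hu Hv.
    pose proof (Rmin_l r3 (Rmin r1 r2 / 4)); pose proof (Rmin_r r3 (Rmin r1 r2 / 4)).
    pose proof (Rmin_l r1 r2); pose proof (Rmin_r r1 r2).
    assert (Huv : box (d / 4) u v) by (apply R3; lra).
    pose proof (inv_correct u v (HS u v Huv)) as [J1 J2].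
    assert (Hxy' := inv_box u v (HS u v Huv)).
    set (x' := inv1 u v) in *; set (y' := inv2 u v) in *.
    set (M := Rmax (Rabs (u - a)) (Rabs (v - b))).
    assert (HM1 : Rabs (u - a) <= M) by apply Rmax_l.
    assert (HM2 : Rabs (v - b) <= M) by apply Rmax_r.
    assert (HMr : M < Rmin r1 r2 / 4) by (apply Rmax_lub_lt; lra).
    pose proof (perturbation_injective x' y' x y Hxy' Hxy) as L.
    rewrite I1, I2, J1, J2 in L.
    pose proof (Rabs_pos (x' - x)); pose proof (Rabs_pos (y' - y)).
    specialize (R1 x' y' ltac:(lra) ltac:(lra)); specialize (R2 x' y' ltac:(lra) ltac:(lra)).
    assert (HX : Rmax (Rabs (x' - x)) (Rabs (y' - y)) <= 4 * M)
      by (apply Rmax_lub; lra).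
    set (q1 := e1 x' y' - _ - _) in R1; set (q2 := e2 x' y' - _ - _) in R2.
    assert (Q1 : Rabs q1 <= eps / 5 * M).
    { apply Rle_trans with (1 := R1); replace (eps / 5 * M) with (eps / 20 * (4 * M)) by field.
      apply Rmult_le_compat_l; lra. }
    assert (Q2 : Rabs q2 <= eps / 5 * M).
    { apply Rle_trans with (1 := R2); replace (eps / 5 * M) with (eps / 20 * (4 * M)) by field.
      apply Rmult_le_compat_l; lra. }
    assert (HJi : 0 < / jac x y <= 2).
    { split; [apply Rinv_0_lt_compat; lra|].
      rewrite <- (Rinv_inv 2); apply Rinv_le_contravar; lra. }
    assert (est : forall p q, Rabs p <= 5 / 4 -> Rabs q <= 5 / 4 ->
      Rabs ((p * q1 + q * q2) * / jac x y) <= eps * M).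
    { intros p q Hp Hq.
      rewrite Rabs_mult, (Rabs_pos_eq (/ jac x y)) by lra.
      pose proof (Rabs_triang (p * q1) (q * q2)) as T; rewrite !Rabs_mult in T.
      assert (T1 : Rabs p * Rabs q1 <= 5 / 4 * (eps / 5 * M))
        by (apply Rmult_le_compat; auto using Rabs_pos).
      assert (T2 : Rabs q * Rabs q2 <= 5 / 4 * (eps / 5 * M))
        by (apply Rmult_le_compat; auto using Rabs_pos).
      replace (eps * M) with ((eps / 2 * M) * 2) by field.
      apply Rmult_le_compat; try lra; apply Rabs_pos. }
    assert (Hj : jac x y <> 0) by lra.
    assert (U : u - a = (1 + dx e1 x y) * (x' - x) + dy e1 x y * (y' - y) + q1)
      by (rewrite <- I1, <- J1; unfold q1; ring).
    assert (V : v - b = dx e2 x y * (x' - x) + (1 + dy e2 x y) * (y' - y) + q2)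
      by (rewrite <- I2, <- J2; unfold q2; ring).
    apply Rabs_le_between in A1, A2, A3, A4.
    split.
    - replace (_ - _) with ((- (1 + dy e2 x y) * q1 + dy e1 x y * q2) * / jac x y).
      + apply est; apply Rabs_le_between; lra.
      + rewrite U, V; unfold jac in *; field; exact Hj.
    - replace (_ - _) with ((dx e2 x y * q1 + - (1 + dx e1 x y) * q2) * / jac x y).
      + apply est; apply Rabs_le_between; lra.
      + rewrite U, V; unfold jac in *; field; exact Hj. }
  split; intros eps; generalize (main eps); apply locally_2d_impl, locally_2d_forall;
    intros u v [H1 H2]; assumption.
Qed.

(** The pullbacks of smooth functions by the inverse form a stable family: by
    the chain rule the derivatives of a pullback are pullbacks of smooth
    functions, the entries of the inverse Jacobian being functions of the
    inverse itself. *)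
Lemma inv_pullback_smooth (g : R -> R -> R) : smooth_on (box d) g ->
  smooth_on (box (d / 4)) (fun a b => g (inv1 a b) (inv2 a b)).
Proof.
  intros Hg.
  exists (fun f => exists h, smooth_on (box d) h /\ f = fun a b => h (inv1 a b) (inv2 a b)).
  split; [|exists g; auto].
  clear g Hg; intros f [h [Hh ->]].
  pose proof (box_open d) as HO.
  assert (SJ : smooth_on (box d) (fun x y => / jac x y)).
  { apply smooth_on_inv.
    - intros x y H; pose proof (jac_lower x y H); lra.
    - unfold jac; apply smooth_on_minus; auto; apply smooth_on_mult;
        try (apply smooth_on_plus; [apply smooth_on_const|]);
        auto using smooth_on_dx, smooth_on_dy. }
  set (h1 := fun x y => dx h x y * ((1 + dy e2 x y) * / jac x y)
    + dy h x y * (- dx e2 x y * / jac x y)).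
  set (h2 := fun x y => dx h x y * (- dy e1 x y * / jac x y)
    + dy h x y * ((1 + dx e1 x y) * / jac x y)).
  exists (fun a b => h1 (inv1 a b) (inv2 a b)), (fun a b => h2 (inv1 a b) (inv2 a b)).
  split; [|split].
  - exists h1; split; [|reflexivity].
    repeat first [apply smooth_on_plus | apply smooth_on_mult | apply smooth_on_const
      | apply smooth_on_opp | apply smooth_on_dx | apply smooth_on_dy]; assumption.
  - exists h2; split; [|reflexivity].
    repeat first [apply smooth_on_plus | apply smooth_on_mult | apply smooth_on_const
      | apply smooth_on_opp | apply smooth_on_dx | apply smooth_on_dy]; assumption.
  - intros a b Hab; destruct (inv_differentiable a b Hab) as [D1 D2].
    apply differentiable_pt_lim_comp; auto.
    apply (smooth_on_differentiable (box d)); auto.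
    apply inv_box; destruct Hab; lra.
Qed.

End LocalInverse.

Lemma smooth_germ_small (f : R -> R -> R) (k : R) :
  smooth_germ f -> f 0 0 = 0 -> 0 < k -> exists r : posreal,
    forall x y, box r x y -> Rabs (f x y) <= k.
Proof.
  intros Hf H0 Hk; apply smooth_germ_iff in Hf; destruct Hf as [d Hf].
  assert (Hb : box d 0 0) by (split; rewrite Rabs_R0; apply cond_pos).
  destruct (smooth_on_continuous _ _ _ _ (box_open d) Hf Hb (mkposreal k Hk)) as [r Hr].
  exists r; intros x y [Hx Hy]; left.
  replace (f x y) with (f x y - f 0 0) by (rewrite H0; ring).
  apply Hr; rewrite Rminus_0_r; assumption.
Qed.

Lemma smooth_germ_dx (f : R -> R -> R) : smooth_germ f -> smooth_germ (dx f).
Proof.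
  intros Hf; apply smooth_germ_iff in Hf; destruct Hf as [d Hf].
  apply smooth_germ_iff; exists d; apply smooth_on_dx; auto using box_open.
Qed.

Lemma smooth_germ_dy (f : R -> R -> R) : smooth_germ f -> smooth_germ (dy f).
Proof.
  intros Hf; apply smooth_germ_iff in Hf; destruct Hf as [d Hf].
  apply smooth_germ_iff; exists d; apply smooth_on_dy; auto using box_open.
Qed.

Lemma box_mono (r s x y : R) : r <= s -> box r x y -> box s x y.
Proof. intros H [Hx Hy]; split; lra. Qed.

Lemma small_perturbation_box (e : R -> R -> R) :
  smooth_germ e -> dx e 0 0 = 0 -> dy e 0 0 = 0 ->
  exists r : posreal, forall s, s <= r -> smooth_on (box s) e /\
    forall x y, box s x y -> Rabs (dx e x y) <= / 4 /\ Rabs (dy e x y) <= / 4.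
Proof.
  intros He Hx Hy.
  destruct (smooth_germ_small (dx e) (/ 4)) as [r1 H1]; auto using smooth_germ_dx; [lra|].
  destruct (smooth_germ_small (dy e) (/ 4)) as [r2 H2]; auto using smooth_germ_dy; [lra|].
  apply smooth_germ_iff in He; destruct He as [r3 H3].
  assert (Hr : 0 < Rmin r3 (Rmin r1 r2)) by (repeat apply Rmin_pos; apply cond_pos).
  exists (mkposreal _ Hr); simpl; intros s Hs.
  pose proof (Rmin_l r3 (Rmin r1 r2)); pose proof (Rmin_r r3 (Rmin r1 r2)).
  pose proof (Rmin_l r1 r2); pose proof (Rmin_r r1 r2).
  split.
  - apply (smooth_on_sub _ (box r3)); auto; intros x y; apply box_mono; lra.
  - intros x y H'; split; [apply H1|apply H2]; revert H'; apply box_mono; lra.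
Qed.

(** The inverse function theorem for maps tangent to the identity at the
    origin. *)
Lemma diffeo_germ_of_tangent_identity (e1 e2 : R -> R -> R) :
  smooth_germ e1 -> smooth_germ e2 -> e1 0 0 = 0 -> e2 0 0 = 0 ->
  dx e1 0 0 = 0 -> dy e1 0 0 = 0 -> dx e2 0 0 = 0 -> dy e2 0 0 = 0 ->
  diffeo_germ (fun x y => x + e1 x y) (fun x y => y + e2 x y).
Proof.
  intros S1 S2 Z1 Z2 X1 Y1 X2 Y2.
  destruct (small_perturbation_box e1 S1 X1 Y1) as [r1 H1].
  destruct (small_perturbation_box e2 S2 X2 Y2) as [r2 H2].
  clear S1 S2 X1 Y1 X2 Y2.
  set (d := Rmin r1 r2).
  assert (Hd : 0 < d) by (apply Rmin_pos; apply cond_pos).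
  destruct (H1 d (Rmin_l _ _)) as [S1 B1]; destruct (H2 d (Rmin_r _ _)) as [S2 B2].
  clear H1 H2.
  pose proof (box_open d) as HO.
  assert (Hd4 : 0 < d / 4) by lra.
  assert (Hd8 : 0 < d / 8) by lra.
  assert (HS : forall u v, box (d / 4) u v -> Rabs u + Rabs v < d / 2)
    by (intros u v [Hu Hv]; lra).
  assert (I0 : inv1 e1 e2 0 0 = 0 /\ inv2 e1 e2 0 0 = 0).
  { pose proof (inv_bound d e1 e2 Hd S1 S2 Z1 Z2 B1 B2 0 0) as H.
    rewrite Rabs_R0 in H; specialize (H ltac:(lra)).
    pose proof (Rabs_pos (inv1 e1 e2 0 0)); pose proof (Rabs_pos (inv2 e1 e2 0 0)).
    split; apply Rabs_eq_0; lra. }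
  assert (left_inv : forall x y, Rabs x < d / 8 -> Rabs y < d / 8 ->
    inv1 e1 e2 (x + e1 x y) (y + e2 x y) = x /\
    inv2 e1 e2 (x + e1 x y) (y + e2 x y) = y).
  { intros x y Hx Hy.
    assert (Hxy : box d x y) by (split; lra).
    assert (Hab : Rabs (x + e1 x y) + Rabs (y + e2 x y) < d / 2).
    { pose proof (perturbation_contracts d e1 e2 S1 S2 B1 B2 x y 0 0 Hxy
        ltac:(split; rewrite Rabs_R0; lra)) as H.
      rewrite Z1, Z2, !Rminus_0_r in H.
      pose proof (Rabs_triang x (e1 x y)); pose proof (Rabs_triang y (e2 x y)); lra. }
    destruct (inv_correct d e1 e2 Hd S1 S2 Z1 Z2 B1 B2 _ _ Hab) as [C1 C2].
    pose proof (perturbation_injective d e1 e2 S1 S2 B1 B2 _ _ x y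
      (inv_box d e1 e2 Hd S1 S2 Z1 Z2 B1 B2 _ _ Hab) Hxy) as H.
    rewrite C1, C2, !Rminus_diag, Rabs_R0 in H.
    set (u := inv1 e1 e2 (x + _) _) in *; set (v := inv2 e1 e2 (x + _) _) in *.
    pose proof (Rabs_pos (u - x)); pose proof (Rabs_pos (v - y)).
    split; apply Rminus_diag_uniq, Rabs_eq_0; lra. }
  split.
  - split; (split; [apply smooth_germ_iff; exists (mkposreal d Hd)|cbv beta; lra]);
      apply smooth_on_plus; auto using smooth_on_fst, smooth_on_snd.
  - exists (inv1 e1 e2), (inv2 e1 e2); split; [|split; [|split; [|split]]].
    + split; (split; [apply smooth_germ_iff; exists (mkposreal _ Hd4); simpl|apply I0]).
      * apply (inv_pullback_smooth d e1 e2 Hd S1 S2 Z1 Z2 B1 B2 (fun x _ => x)).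
        auto using smooth_on_fst.
      * apply (inv_pullback_smooth d e1 e2 Hd S1 S2 Z1 Z2 B1 B2 (fun _ y => y)).
        auto using smooth_on_snd.
    + exists (mkposreal _ Hd8); simpl; intros u v Hu Hv; rewrite Rminus_0_r in Hu, Hv.
      apply left_inv; assumption.
    + exists (mkposreal _ Hd8); simpl; intros u v Hu Hv; rewrite Rminus_0_r in Hu, Hv.
      apply left_inv; assumption.
    + exists (mkposreal _ Hd4); simpl; intros u v Hu Hv; rewrite Rminus_0_r in Hu, Hv.
      apply (inv_correct d); auto; lra.
    + exists (mkposreal _ Hd4); simpl; intros u v Hu Hv; rewrite Rminus_0_r in Hu, Hv.
      apply (inv_correct d); auto; lra.
Qed.

(** * Wirtinger derivatives and the complex Taylor expansion *)

Lemma dx_ext (U : R -> R -> Prop) (f g : R -> R -> R) (x y : R) : open_plane U ->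
  (forall u v, U u v -> f u v = g u v) -> U x y -> dx f x y = dx g x y.
Proof.
  intros HU E Hxy; apply Derive_ext_loc.
  generalize (locally_2d_1d_const_y U x y (HU x y Hxy)); apply filter_imp; auto.
Qed.

Lemma dy_ext (U : R -> R -> Prop) (f g : R -> R -> R) (x y : R) : open_plane U ->
  (forall u v, U u v -> f u v = g u v) -> U x y -> dy f x y = dy g x y.
Proof.
  intros HU E Hxy; apply Derive_ext_loc.
  generalize (locally_2d_1d_const_x U x y (HU x y Hxy)); apply filter_imp; auto.
Qed.

Lemma derivatives_lincomb (U : R -> R -> Prop) (a b : R) (f g : R -> R -> R) (x y : R) :
  open_plane U -> smooth_on U f -> smooth_on U g -> U x y ->
  dx (fun u v => a * f u v + b * g u v) x y = a * dx f x y + b * dx g x y /\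
  dy (fun u v => a * f u v + b * g u v) x y = a * dy f x y + b * dy g x y.
Proof.
  intros HU Hf Hg Hxy; apply differentiable_pt_lim_unique.
  apply (differentiable_pt_lim_comp (fun s t => a * s + b * t)).
  - apply differentiable_pt_lim_linear.
  - apply (smooth_on_differentiable U); assumption.
  - apply (smooth_on_differentiable U); assumption.
Qed.

Lemma derivatives_mult (U : R -> R -> Prop) (f g : R -> R -> R) (x y : R) :
  open_plane U -> smooth_on U f -> smooth_on U g -> U x y ->
  dx (fun u v => f u v * g u v) x y = dx f x y * g x y + f x y * dx g x y /\
  dy (fun u v => f u v * g u v) x y = dy f x y * g x y + f x y * dy g x y.
Proof.
  intros HU Hf Hg Hxy; apply differentiable_pt_lim_unique.
  apply differentiable_pt_lim_mult; apply (smooth_on_differentiable U); assumption.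
Qed.

Lemma dx_dy_comm (U : R -> R -> Prop) (f : R -> R -> R) (x y : R) :
  open_plane U -> smooth_on U f -> U x y -> dx (dy f) x y = dy (dx f) x y.
Proof.
  intros HU Hf Hxy; apply Schwarz.
  - destruct (HU x y Hxy) as [e He]; exists e; intros u v Hu Hv.
    specialize (He u v Hu Hv).
    assert (D : forall g, smooth_on U g ->
      ex_derive (fun z => g z v) u /\ ex_derive (fun z => g u z) v).
    { intros g Hg; split; eexists; apply (smooth_on_is_derive U g u v); assumption. }
    split; [apply D, Hf|split; [apply D, Hf|split]].
    + apply (D (dy f)), smooth_on_dy; assumption.
    + apply (D (dx f)), smooth_on_dx; assumption.
  - apply (smooth_on_continuous U (dx (dy f))); auto using smooth_on_dx, smooth_on_dy.
  - apply (smooth_on_continuous U (dy (dx f))); auto using smooth_on_dx, smooth_on_dy.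
Qed.

Definition re (F : R -> R -> C) (x y : R) : R := Re (F x y).
Definition im (F : R -> R -> C) (x y : R) : R := Im (F x y).
Definition csmooth_on (U : R -> R -> Prop) (F : R -> R -> C) : Prop :=
  smooth_on U (re F) /\ smooth_on U (im F).

Lemma csmooth_on_const U (c : C) : csmooth_on U (fun _ _ => c).
Proof. split; [exact (smooth_on_const U (Re c))|exact (smooth_on_const U (Im c))]. Qed.

Lemma csmooth_on_plus U F G :
  csmooth_on U F -> csmooth_on U G -> csmooth_on U (fun x y => F x y + G x y)%C.
Proof.
  intros [F1 F2] [G1 G2]; split.
  - apply (smooth_on_plus U (re F) (re G)); assumption.
  - apply (smooth_on_plus U (im F) (im G)); assumption.
Qed.

Lemma csmooth_on_mult U F G : open_plane U ->
  csmooth_on U F -> csmooth_on U G -> csmooth_on U (fun x y => F x y * G x y)%C.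
Proof.
  intros HU [F1 F2] [G1 G2]; split.
  - apply (smooth_on_minus U (fun x y => re F x y * re G x y)
      (fun x y => im F x y * im G x y)); auto; apply smooth_on_mult; assumption.
  - apply (smooth_on_plus U (fun x y => re F x y * im G x y)
      (fun x y => im F x y * re G x y)); apply smooth_on_mult; assumption.
Qed.

Lemma csmooth_on_conj U F : open_plane U ->
  csmooth_on U F -> csmooth_on U (fun x y => Cconj (F x y)).
Proof. intros HU [F1 F2]; split; [exact F1|apply (smooth_on_opp U (im F)); auto]. Qed.

Lemma csmooth_on_pow U F n : open_plane U ->
  csmooth_on U F -> csmooth_on U (fun x y => F x y ^ n)%C.
Proof.
  intros HU HF; induction n as [|n IH]; [exact (csmooth_on_const U 1)|].
  apply (csmooth_on_mult U F (fun x y => F x y ^ n)%C); assumption.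
Qed.

Definition zz (x y : R) : C := (x, y).

Lemma csmooth_on_zz U : open_plane U -> csmooth_on U zz.
Proof. intros HU; split; [apply smooth_on_fst|apply smooth_on_snd]; exact HU. Qed.

Definition monomial (i j : nat) (x y : R) : C := (zz x y ^ i * Cconj (zz x y) ^ j)%C.

Lemma csmooth_on_monomial U i j : open_plane U -> csmooth_on U (monomial i j).
Proof.
  intros HU; apply csmooth_on_mult; auto; apply csmooth_on_pow; auto;
    [|apply csmooth_on_conj]; auto using csmooth_on_zz.
Qed.

(** The Wirtinger derivatives d/dz = (d/dx - i d/dy) / 2 and
    d/dw = (d/dx + i d/dy) / 2, where w is the conjugate of z, written in real
    and imaginary parts. *)
Definition Dz (F : R -> R -> C) (x y : R) : C :=
  (/ 2 * dx (re F) x y + / 2 * dy (im F) x y,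
   / 2 * dx (im F) x y + - / 2 * dy (re F) x y).
Definition Dzb (F : R -> R -> C) (x y : R) : C :=
  (/ 2 * dx (re F) x y + - / 2 * dy (im F) x y,
   / 2 * dx (im F) x y + / 2 * dy (re F) x y).

Lemma csmooth_on_Dz U F : open_plane U -> csmooth_on U F -> csmooth_on U (Dz F).
Proof.
  intros HU [F1 F2]; split; apply smooth_on_plus; apply smooth_on_mult;
    auto using smooth_on_const, smooth_on_dx, smooth_on_dy.
Qed.

Lemma csmooth_on_Dzb U F : open_plane U -> csmooth_on U F -> csmooth_on U (Dzb F).
Proof.
  intros HU [F1 F2]; split; apply smooth_on_plus; apply smooth_on_mult;
    auto using smooth_on_const, smooth_on_dx, smooth_on_dy.
Qed.

Definition eq_on (U : R -> R -> Prop) (F G : R -> R -> C) : Prop :=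
  forall x y, U x y -> F x y = G x y.

Lemma Dz_ext U F G : open_plane U -> eq_on U F G -> eq_on U (Dz F) (Dz G).
Proof.
  intros HU E x y Hxy; unfold Dz.
  assert (E1 : forall u v, U u v -> re F u v = re G u v)
    by (intros; unfold re; rewrite E; auto).
  assert (E2 : forall u v, U u v -> im F u v = im G u v)
    by (intros; unfold im; rewrite E; auto).
  rewrite (dx_ext U _ _ x y HU E1 Hxy), (dx_ext U _ _ x y HU E2 Hxy),
    (dy_ext U _ _ x y HU E1 Hxy), (dy_ext U _ _ x y HU E2 Hxy); reflexivity.
Qed.

Lemma Dzb_ext U F G : open_plane U -> eq_on U F G -> eq_on U (Dzb F) (Dzb G).
Proof.
  intros HU E x y Hxy; unfold Dzb.
  assert (E1 : forall u v, U u v -> re F u v = re G u v)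
    by (intros; unfold re; rewrite E; auto).
  assert (E2 : forall u v, U u v -> im F u v = im G u v)
    by (intros; unfold im; rewrite E; auto).
  rewrite (dx_ext U _ _ x y HU E1 Hxy), (dx_ext U _ _ x y HU E2 Hxy),
    (dy_ext U _ _ x y HU E1 Hxy), (dy_ext U _ _ x y HU E2 Hxy); reflexivity.
Qed.

Lemma derivatives_Dz U F x y : open_plane U -> csmooth_on U F -> U x y ->
  let u := re F in let v := im F in
  (dx (re (Dz F)) x y = / 2 * dx (dx u) x y + / 2 * dx (dy v) x y /\
   dy (re (Dz F)) x y = / 2 * dy (dx u) x y + / 2 * dy (dy v) x y) /\
  (dx (im (Dz F)) x y = / 2 * dx (dx v) x y + - / 2 * dx (dy u) x y /\
   dy (im (Dz F)) x y = / 2 * dy (dx v) x y + - / 2 * dy (dy u) x y).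
Proof.
  intros HU [F1 F2] Hxy u v; split;
    apply (derivatives_lincomb U); auto using smooth_on_dx, smooth_on_dy.
Qed.

Lemma derivatives_Dzb U F x y : open_plane U -> csmooth_on U F -> U x y ->
  let u := re F in let v := im F in
  (dx (re (Dzb F)) x y = / 2 * dx (dx u) x y + - / 2 * dx (dy v) x y /\
   dy (re (Dzb F)) x y = / 2 * dy (dx u) x y + - / 2 * dy (dy v) x y) /\
  (dx (im (Dzb F)) x y = / 2 * dx (dx v) x y + / 2 * dx (dy u) x y /\
   dy (im (Dzb F)) x y = / 2 * dy (dx v) x y + / 2 * dy (dy u) x y).
Proof.
  intros HU [F1 F2] Hxy u v; split;
    apply (derivatives_lincomb U); auto using smooth_on_dx, smooth_on_dy.
Qed.

Lemma Dz_Dzb_comm U F : open_plane U -> csmooth_on U F ->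
  eq_on U (Dz (Dzb F)) (Dzb (Dz F)).
Proof.
  intros HU HF x y Hxy.
  destruct (derivatives_Dz U F x y HU HF Hxy) as [[A1 A2] [A3 A4]].
  destruct (derivatives_Dzb U F x y HU HF Hxy) as [[B1 B2] [B3 B4]].
  unfold Dz at 1; unfold Dzb at 5; rewrite A1, A2, A3, A4, B1, B2, B3, B4.
  destruct HF as [F1 F2].
  rewrite (dx_dy_comm U _ x y HU F1 Hxy), (dx_dy_comm U _ x y HU F2 Hxy).
  f_equal; ring.
Qed.

(** The factorisation of the Laplacian as 4 (d/dz) (d/dw); the scalar c allows
    the identity to be iterated. *)
Lemma Dz_Dzb_laplacian U (c : R) (f : R -> R -> R) : open_plane U -> smooth_on U f ->
  eq_on U (Dz (Dzb (fun x y => RtoC (c * f x y))))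
    (fun x y => RtoC (c / 4 * laplacian f x y)).
Proof.
  intros HU Hf x y Hxy.
  set (F := fun x y => RtoC (c * f x y)).
  assert (HF : csmooth_on U F).
  { split; [|exact (smooth_on_const U 0)].
    apply (smooth_on_mult U (fun _ _ => c) f); auto using smooth_on_const. }
  destruct (derivatives_Dzb U F x y HU HF Hxy) as [[B1 B2] [B3 B4]].
  unfold Dz; rewrite B1, B2, B3, B4.
  assert (K : forall u v, U u v -> dx (re F) u v = c * dx f u v + 0 * dy f u v /\
    dy (re F) u v = 0 * dx f u v + c * dy f u v).
  { intros u v Huv.
    destruct (derivatives_lincomb U c 0 f f u v HU Hf Hf Huv) as [C1 C2].
    rewrite (dx_ext U (re F) (fun u v => c * f u v + 0 * f u v)), C1,
      (dy_ext U (re F) (fun u v => c * f u v + 0 * f u v)), C2; auto;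
      try (intros; unfold re, F; simpl; ring).
    split; ring. }
  assert (Kd := derivatives_lincomb U).
  assert (Hx := smooth_on_dx U f HU Hf); assert (Hy := smooth_on_dy U f HU Hf).
  assert (Z : (forall u v, dx (im F) u v = 0) /\ (forall u v, dy (im F) u v = 0)).
  { split; intros u v; [apply (Derive_const 0)|apply (Derive_const 0)]. }
  destruct Z as [Z1 Z2].
  rewrite (dx_ext U (dx (re F)) (fun u v => c * dx f u v + 0 * dy f u v) x y HU
    (fun u v H => proj1 (K u v H)) Hxy).
  rewrite (dy_ext U (dx (re F)) (fun u v => c * dx f u v + 0 * dy f u v) x y HU
    (fun u v H => proj1 (K u v H)) Hxy).
  rewrite (dx_ext U (dy (re F)) (fun u v => 0 * dx f u v + c * dy f u v) x y HU
    (fun u v H => proj2 (K u v H)) Hxy).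
  rewrite (dy_ext U (dy (re F)) (fun u v => 0 * dx f u v + c * dy f u v) x y HU
    (fun u v H => proj2 (K u v H)) Hxy).
  rewrite (proj1 (Kd c 0 _ _ x y HU Hx Hy Hxy)), (proj2 (Kd c 0 _ _ x y HU Hx Hy Hxy)),
    (proj1 (Kd 0 c _ _ x y HU Hx Hy Hxy)), (proj2 (Kd 0 c _ _ x y HU Hx Hy Hxy)).
  rewrite (dx_dy_comm U f x y HU Hf Hxy).
  assert (W : forall h, (forall u v, h u v = 0) -> dx h x y = 0 /\ dy h x y = 0).
  { intros h Hh; split; [unfold dx|unfold dy];
      (rewrite (Derive_ext _ (fun _ => 0)); [apply Derive_const|auto]). }
  rewrite (proj1 (W _ Z1)), (proj2 (W _ Z1)), (proj1 (W _ Z2)), (proj2 (W _ Z2)).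
  change (laplacian f x y) with (dx (dx f) x y + dy (dy f) x y).
  unfold RtoC; f_equal; field.
Qed.

Definition wirtinger (i j : nat) (F : R -> R -> C) : R -> R -> C :=
  Nat.iter i Dz (Nat.iter j Dzb F).

Lemma iter_Dz_ext U n F G : open_plane U -> eq_on U F G ->
  eq_on U (Nat.iter n Dz F) (Nat.iter n Dz G).
Proof. intros HU E; induction n as [|n IH]; simpl; auto using Dz_ext. Qed.

Lemma iter_Dzb_ext U n F G : open_plane U -> eq_on U F G ->
  eq_on U (Nat.iter n Dzb F) (Nat.iter n Dzb G).
Proof. intros HU E; induction n as [|n IH]; simpl; auto using Dzb_ext. Qed.

Lemma csmooth_on_iter_Dz U n F : open_plane U -> csmooth_on U F -> csmooth_on U (Nat.iter n Dz F).
Proof. intros HU HF; induction n as [|n IH]; simpl; auto using csmooth_on_Dz. Qed.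

Lemma csmooth_on_iter_Dzb U n F : open_plane U -> csmooth_on U F -> csmooth_on U (Nat.iter n Dzb F).
Proof. intros HU HF; induction n as [|n IH]; simpl; auto using csmooth_on_Dzb. Qed.

Lemma csmooth_on_wirtinger U i j F :
  open_plane U -> csmooth_on U F -> csmooth_on U (wirtinger i j F).
Proof. intros; apply csmooth_on_iter_Dz, csmooth_on_iter_Dzb; assumption. Qed.

Lemma eq_on_trans U F G H : eq_on U F G -> eq_on U G H -> eq_on U F H.
Proof. intros E1 E2 x y Hxy; rewrite E1, E2; auto. Qed.

Lemma eq_on_sym U F G : eq_on U F G -> eq_on U G F.
Proof. intros E x y Hxy; rewrite E; auto. Qed.

Lemma Dzb_iter_Dz U i F : open_plane U -> csmooth_on U F ->
  eq_on U (Dzb (Nat.iter i Dz F)) (Nat.iter i Dz (Dzb F)).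
Proof.
  intros HU HF; induction i as [|i IH]; simpl; [intros x y _; reflexivity|].
  apply eq_on_trans with (Dz (Dzb (Nat.iter i Dz F))).
  - apply eq_on_sym, Dz_Dzb_comm; auto using csmooth_on_iter_Dz.
  - apply Dz_ext; assumption.
Qed.

Lemma iter_Dzb_iter_Dz U i j F : open_plane U -> csmooth_on U F ->
  eq_on U (Nat.iter j Dzb (Nat.iter i Dz F)) (Nat.iter i Dz (Nat.iter j Dzb F)).
Proof.
  intros HU HF; induction j as [|j IH]; simpl; [intros x y _; reflexivity|].
  apply eq_on_trans with (Dzb (Nat.iter i Dz (Nat.iter j Dzb F))).
  - apply Dzb_ext; assumption.
  - apply Dzb_iter_Dz; auto using csmooth_on_iter_Dzb.
Qed.

Lemma wirtinger_add U i j p q F : open_plane U -> csmooth_on U F ->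
  eq_on U (wirtinger (i + p) (j + q) F) (wirtinger i j (wirtinger p q F)).
Proof.
  intros HU HF; unfold wirtinger; rewrite !Nat.iter_add.
  apply iter_Dz_ext; auto.
  apply eq_on_sym, iter_Dzb_iter_Dz; auto using csmooth_on_iter_Dzb.
Qed.

Lemma wirtinger_zero U i j F : open_plane U -> eq_on U F (fun _ _ => 0) ->
  eq_on U (wirtinger i j F) (fun _ _ => 0).
Proof.
  intros HU E.
  assert (Z : forall h : R -> R, (forall t, h t = 0) -> forall s, Derive h s = 0)
    by (intros h Hh s; rewrite (Derive_ext _ (fun _ => 0)); [apply Derive_const|auto]).
  apply eq_on_trans with (wirtinger i j (fun _ _ => 0)).
  { apply iter_Dz_ext, iter_Dzb_ext; assumption. }
  assert (Z1 : eq_on U (Dz (fun _ _ => 0)) (fun _ _ => 0)).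
  { intros x y _; unfold Dz, dx, dy; rewrite !Z by reflexivity.
    unfold RtoC; f_equal; ring. }
  assert (Z2 : eq_on U (Dzb (fun _ _ => 0)) (fun _ _ => 0)).
  { intros x y _; unfold Dzb, dx, dy; rewrite !Z by reflexivity.
    unfold RtoC; f_equal; ring. }
  unfold wirtinger; apply eq_on_trans with (Nat.iter i Dz (fun _ _ => RtoC 0)).
  - apply iter_Dz_ext; auto.
    induction j as [|j IH]; simpl; [intros x y _; reflexivity|].
    apply eq_on_trans with (2 := Z2), Dzb_ext; assumption.
  - induction i as [|i IH]; simpl; [intros x y _; reflexivity|].
    apply eq_on_trans with (2 := Z1), Dz_ext; assumption.
Qed.

Definition remainderC (n : nat) (F : R -> R -> C) (x y : R) : C :=
  (remainder n (re F) x y, remainder n (im F) x y).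

Lemma csmooth_on_remainder d n F : csmooth_on (box d) F -> csmooth_on (box d) (remainderC n F).
Proof.
  intros [F1 F2]; split; [apply (remainder_smooth d n (re F))|
    apply (remainder_smooth d n (im F))]; assumption.
Qed.

Lemma remainder_ext d n f g x y : (forall u v, box d u v -> f u v = g u v) ->
  box d x y -> remainder n f x y = remainder n g x y.
Proof.
  intros E Hxy; destruct n as [|n]; simpl; [auto|].
  apply RInt_ext; rewrite Rmin_left, Rmax_right by lra; intros t Ht.
  rewrite E; auto; apply box_shrink; auto; lra.
Qed.

Lemma remainderC_ext d n F G : eq_on (box d) F G ->
  eq_on (box d) (remainderC n F) (remainderC n G).
Proof.
  intros E x y Hxy; unfold remainderC; f_equal; apply (remainder_ext d); auto;
    intros u v Huv; [unfold re|unfold im]; rewrite E; auto.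
Qed.

Lemma remainder_lincomb d n a b f g x y :
  smooth_on (box d) f -> smooth_on (box d) g -> box d x y ->
  remainder n (fun u v => a * f u v + b * g u v) x y
    = a * remainder n f x y + b * remainder n g x y.
Proof.
  intros Hf Hg Hxy; destruct n as [|n]; simpl; [reflexivity|].
  apply is_RInt_unique.
  assert (If := RInt_correct _ _ _ (ray_integrable d _ _ (weight_pow n) Hf x y Hxy)).
  assert (Ig := RInt_correct _ _ _ (ray_integrable d _ _ (weight_pow n) Hg x y Hxy)).
  generalize (is_RInt_plus _ _ _ _ _ _
    (is_RInt_scal _ _ _ a _ If) (is_RInt_scal _ _ _ b _ Ig)).
  apply is_RInt_ext; intros t _; unfold plus, scal; simpl; unfold mult; simpl; ring.
Qed.

(** The step of Taylor's formula in the basis z, w, because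
    x d/dx + y d/dy = z d/dz + w d/dw. *)
Lemma remainderC_step (n : nat) : exists c : R,
  forall d F x y, csmooth_on (box d) F -> box d x y ->
  remainderC n F x y = (c * (F 0 0 + zz x y * remainderC (S n) (Dz F) x y
    + Cconj (zz x y) * remainderC (S n) (Dzb F) x y))%C.
Proof.
  destruct (remainder_step n) as [c Hc]; exists c; intros d F x y [F1 F2] Hxy.
  unfold remainderC at 1; rewrite (Hc d _ x y F1 Hxy), (Hc d _ x y F2 Hxy).
  assert (HO := box_open d).
  assert (X1 := smooth_on_dx _ _ HO F1); assert (X2 := smooth_on_dx _ _ HO F2).
  assert (Y1 := smooth_on_dy _ _ HO F1); assert (Y2 := smooth_on_dy _ _ HO F2).
  unfold remainderC.
  assert (E1 : remainder (S n) (re (Dz F)) x y =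
    / 2 * remainder (S n) (dx (re F)) x y + / 2 * remainder (S n) (dy (im F)) x y)
    by (apply (remainder_lincomb d); assumption).
  assert (E2 : remainder (S n) (im (Dz F)) x y =
    / 2 * remainder (S n) (dx (im F)) x y + - / 2 * remainder (S n) (dy (re F)) x y)
    by (apply (remainder_lincomb d); assumption).
  assert (E3 : remainder (S n) (re (Dzb F)) x y =
    / 2 * remainder (S n) (dx (re F)) x y + - / 2 * remainder (S n) (dy (im F)) x y)
    by (apply (remainder_lincomb d); assumption).
  assert (E4 : remainder (S n) (im (Dzb F)) x y =
    / 2 * remainder (S n) (dx (im F)) x y + / 2 * remainder (S n) (dy (re F)) x y)
    by (apply (remainder_lincomb d); assumption).
  rewrite E1, E2, E3, E4.
  unfold Cmult, Cplus, Cconj, zz, RtoC, re, im, Re, Im; cbn [fst snd].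
  f_equal; field.
Qed.

(** Taylor's formula as an induction principle: a class of functions closed
    under addition that contains all multiples of the monomials of degree N and
    all Taylor terms of lower degree contains F. This form avoids writing the
    expansion as a sum and keeping track of its multinomial coefficients. *)
Lemma taylor_membership d N (J : (R -> R -> C) -> Prop) F : 0 < d ->
  csmooth_on (box d) F ->
  (forall G H, eq_on (box d) G H -> J G -> J H) ->
  (forall G H, J G -> J H -> J (fun x y => G x y + H x y)%C) ->
  (forall i j G, (i + j = N)%nat -> csmooth_on (box d) G ->
     J (fun x y => monomial i j x y * G x y)%C) ->
  (forall i j (c : C), (i + j < N)%nat ->
     J (fun x y => monomial i j x y * (c * wirtinger i j F 0 0))%C) ->
  J F.
Proof.
  intros Hd HF Jext Jplus Jtop Jlow.
  assert (HO := box_open d).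
  (* Descending induction on the degree i + j, from N down to 0. *)
  assert (main : forall m i j (a : C), (i + j + m = N)%nat ->
    J (fun x y => monomial i j x y * (a * remainderC (i + j) (wirtinger i j F) x y))%C).
  { induction m as [|m IH]; intros i j a Hij.
    - apply (Jtop i j (fun x y => a * remainderC (i + j) (wirtinger i j F) x y)%C); [lia|].
      apply csmooth_on_mult;
        auto using csmooth_on_const, csmooth_on_remainder, csmooth_on_wirtinger.
    - destruct (remainderC_step (i + j)) as [c Hc].
      assert (H1 := IH (S i) j (a * c)%C ltac:(lia)).
      assert (H2 := IH i (S j) (a * c)%C ltac:(lia)).
      generalize (Jplus _ _ (Jlow i j (a * c)%C ltac:(lia)) (Jplus _ _ H1 H2)).
      apply Jext; intros x y Hxy.
      rewrite (Hc d (wirtinger i j F) x y (csmooth_on_wirtinger _ i j F HO HF) Hxy).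
      rewrite (remainderC_ext d _ _ _ (Dzb_iter_Dz _ i (Nat.iter j Dzb F) HO
        (csmooth_on_iter_Dzb _ j F HO HF)) x y Hxy : remainderC _ (Dzb (wirtinger i j F)) x y = _).
      replace (i + S j)%nat with (S i + j)%nat by lia.
      change (Nat.iter i Dz (Dzb (Nat.iter j Dzb F))) with (wirtinger i (S j) F).
      change (Dz (wirtinger i j F)) with (wirtinger (S i) j F).
      change (S (i + j)) with (S i + j)%nat.
      unfold monomial; rewrite !Cpow_S; ring. }
  apply Jext with (fun x y => monomial 0 0 x y * (1 * remainderC 0 (wirtinger 0 0 F) x y))%C.
  - intros x y _; unfold monomial, remainderC; simpl.
    replace (re _ x y, im _ x y) with (F x y) by (unfold re, im; destruct (F x y); reflexivity).
    ring.
  - apply (main N); reflexivity.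
Qed.

(** * Germs and order of vanishing *)

Lemma germ_eq_box f g : germ_eq f g <->
  exists d : posreal, forall x y, box d x y -> f x y = g x y.
Proof.
  split; intros [d H]; exists d.
  - intros x y [Hx Hy]; apply H; rewrite Rminus_0_r; assumption.
  - intros u v Hu Hv; rewrite Rminus_0_r in Hu, Hv; apply H; split; assumption.
Qed.

Lemma smooth_germ_common f g : smooth_germ f -> smooth_germ g ->
  exists d : posreal, smooth_on (box d) f /\ smooth_on (box d) g.
Proof.
  intros Hf Hg; apply smooth_germ_iff in Hf, Hg.
  destruct Hf as [d1 H1]; destruct Hg as [d2 H2].
  assert (Hd : 0 < Rmin d1 d2) by (apply Rmin_pos; apply cond_pos).
  exists (mkposreal _ Hd); simpl; split.
  - apply (smooth_on_sub _ (box d1)); auto; intros x y; apply box_mono, Rmin_l.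
  - apply (smooth_on_sub _ (box d2)); auto; intros x y; apply box_mono, Rmin_r.
Qed.

Lemma smooth_germ_plus f g : smooth_germ f -> smooth_germ g ->
  smooth_germ (fun x y => f x y + g x y).
Proof.
  intros Hf Hg; destruct (smooth_germ_common f g Hf Hg) as [d [H1 H2]].
  apply smooth_germ_iff; exists d; apply smooth_on_plus; assumption.
Qed.

Lemma smooth_germ_mult f g : smooth_germ f -> smooth_germ g ->
  smooth_germ (fun x y => f x y * g x y).
Proof.
  intros Hf Hg; destruct (smooth_germ_common f g Hf Hg) as [d [H1 H2]].
  apply smooth_germ_iff; exists d; apply smooth_on_mult; assumption.
Qed.

Lemma smooth_germ_of_smooth_on (d : R) f : 0 < d -> smooth_on (box d) f -> smooth_germ f.
Proof. intros Hd Hf; apply smooth_germ_iff; exists (mkposreal d Hd); exact Hf. Qed.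

Lemma smooth_germ_const c : smooth_germ (fun _ _ => c).
Proof. apply (smooth_germ_of_smooth_on 1); [lra|apply smooth_on_const]. Qed.

Lemma smooth_germ_ext f g : germ_eq f g -> smooth_germ f -> smooth_germ g.
Proof.
  intros E Hf; apply germ_eq_box in E; destruct E as [d1 E].
  apply smooth_germ_iff in Hf; destruct Hf as [d2 Hf].
  assert (Hd : 0 < Rmin d1 d2) by (apply Rmin_pos; apply cond_pos).
  apply smooth_germ_iff; exists (mkposreal _ Hd); simpl.
  apply (smooth_on_ext _ f); [apply box_open| |].
  - intros x y H; apply E; revert H; apply box_mono, Rmin_l.
  - apply (smooth_on_sub _ (box d2)); auto; intros x y; apply box_mono, Rmin_r.
Qed.

Lemma smooth_germ_comp f u v : smooth_germ f -> m2 u -> m2 v ->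
  smooth_germ (fun x y => f (u x y) (v x y)).
Proof.
  intros Hf [Hu U0] [Hv V0]; apply smooth_germ_iff in Hf; destruct Hf as [d Hf].
  assert (Hd2 : 0 < d / 2) by (pose proof (cond_pos d); lra).
  destruct (smooth_germ_small u _ Hu U0 Hd2) as [r1 R1].
  destruct (smooth_germ_small v _ Hv V0 Hd2) as [r2 R2].
  destruct (smooth_germ_common u v Hu Hv) as [r3 [S1 S2]].
  assert (Hr : 0 < Rmin r3 (Rmin r1 r2)) by (repeat apply Rmin_pos; apply cond_pos).
  pose proof (Rmin_l r3 (Rmin r1 r2)); pose proof (Rmin_r r3 (Rmin r1 r2)).
  pose proof (Rmin_l r1 r2); pose proof (Rmin_r r1 r2).
  apply (smooth_germ_of_smooth_on _ _ Hr), (smooth_on_comp _ (box d)); auto.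
  - intros x y Hxy; split.
    + apply Rle_lt_trans with (d / 2); [|lra]; apply R1; revert Hxy; apply box_mono; lra.
    + apply Rle_lt_trans with (d / 2); [|lra]; apply R2; revert Hxy; apply box_mono; lra.
  - apply (smooth_on_sub _ (box r3)); auto; intros x y; apply box_mono; lra.
  - apply (smooth_on_sub _ (box r3)); auto; intros x y; apply box_mono; lra.
Qed.

Lemma germ_eq_dx f g : germ_eq f g -> germ_eq (dx f) (dx g).
Proof.
  intros E; apply germ_eq_box in E; destruct E as [d E]; apply germ_eq_box; exists d.
  intros x y; apply dx_ext; auto using box_open.
Qed.

Lemma germ_eq_dy f g : germ_eq f g -> germ_eq (dy f) (dy g).
Proof.
  intros E; apply germ_eq_box in E; destruct E as [d E]; apply germ_eq_box; exists d.
  intros x y; apply dy_ext; auto using box_open.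
Qed.

Lemma germ_eq_sym f g : germ_eq f g -> germ_eq g f.
Proof. intros [d E]; exists d; intros; symmetry; auto. Qed.

Lemma germ_eq_value f g : germ_eq f g -> f 0 0 = g 0 0.
Proof. apply (locally_2d_singleton (fun x y => f x y = g x y)). Qed.

(** The order of vanishing in terms of derivatives: all partial derivatives of
    order less than n are zero at the origin. This formulation passes to
    derivatives by definition, and powers of the maximal ideal reach it through
    the Leibniz rule. *)
Fixpoint vanishes (n : nat) (f : R -> R -> R) : Prop :=
  match n with
  | O => smooth_germ f
  | S m => smooth_germ f /\ f 0 0 = 0 /\ vanishes m (dx f) /\ vanishes m (dy f)
  end.

Lemma vanishes_smooth n f : vanishes n f -> smooth_germ f.
Proof. destruct n; simpl; tauto. Qed.

Lemma vanishes_ext n f g : germ_eq f g -> vanishes n f -> vanishes n g.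
Proof.
  revert f g; induction n as [|n IH]; intros f g E; simpl.
  - apply smooth_germ_ext, E.
  - intros [S [Z [X Y]]]; split; [apply (smooth_germ_ext f); assumption|split; [|split]].
    + rewrite <- (germ_eq_value f g E); exact Z.
    + apply (IH (dx f)); auto using germ_eq_dx.
    + apply (IH (dy f)); auto using germ_eq_dy.
Qed.

Lemma vanishes_pred n f : vanishes n f -> vanishes (pred n) f.
Proof.
  revert f; induction n as [|[|n] IH]; intros f; simpl pred; auto.
  - intros [S _]; exact S.
  - intros [S [Z [X Y]]]; split; [exact S|split; [exact Z|split]].
    + apply (IH (dx f)), X.
    + apply (IH (dy f)), Y.
Qed.

Lemma vanishes_dx n f : vanishes n f -> vanishes (pred n) (dx f).
Proof. destruct n; simpl; [apply smooth_germ_dx|tauto]. Qed.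

Lemma vanishes_dy n f : vanishes n f -> vanishes (pred n) (dy f).
Proof. destruct n; simpl; [apply smooth_germ_dy|tauto]. Qed.

Lemma vanishes_value n f : vanishes (S n) f -> f 0 0 = 0.
Proof. simpl; tauto. Qed.

Lemma vanishes_lincomb n a b f g : vanishes n f -> vanishes n g ->
  vanishes n (fun x y => a * f x y + b * g x y).
Proof.
  revert f g; induction n as [|n IH]; intros f g Hf Hg.
  { apply smooth_germ_plus; apply smooth_germ_mult; auto using smooth_germ_const. }
  assert (Sf := vanishes_smooth _ _ Hf); assert (Sg := vanishes_smooth _ _ Hg).
  destruct (smooth_germ_common f g Sf Sg) as [d [Df Dg]].
  split; [|split; [|split]].
  - apply smooth_germ_plus; apply smooth_germ_mult; auto using smooth_germ_const.
  - rewrite (vanishes_value n f Hf), (vanishes_value n g Hg); ring.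
  - apply (vanishes_ext n (fun x y => a * dx f x y + b * dx g x y)).
    + apply germ_eq_box; exists d; intros x y Hxy; symmetry.
      apply (derivatives_lincomb (box d)); auto using box_open.
    + apply IH; [apply (vanishes_dx (S n))|apply (vanishes_dx (S n))]; assumption.
  - apply (vanishes_ext n (fun x y => a * dy f x y + b * dy g x y)).
    + apply germ_eq_box; exists d; intros x y Hxy; symmetry.
      apply (derivatives_lincomb (box d)); auto using box_open.
    + apply IH; [apply (vanishes_dy (S n))|apply (vanishes_dy (S n))]; assumption.
Qed.

Lemma vanishes_plus n f g : vanishes n f -> vanishes n g ->
  vanishes n (fun x y => f x y + g x y).
Proof.
  intros Hf Hg; apply (vanishes_ext n (fun x y => 1 * f x y + 1 * g x y)).
  - apply locally_2d_forall; intros; ring.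
  - apply vanishes_lincomb; assumption.
Qed.

Lemma vanishes_mult s m n f g : (s <= m + n)%nat -> vanishes m f -> vanishes n g ->
  vanishes s (fun x y => f x y * g x y).
Proof.
  revert m n f g; induction s as [|s IH]; intros m n f g Hs Hf Hg;
    assert (Sf := vanishes_smooth _ _ Hf); assert (Sg := vanishes_smooth _ _ Hg).
  { apply smooth_germ_mult; assumption. }
  destruct (smooth_germ_common f g Sf Sg) as [d [Df Dg]].
  split; [|split; [|split]].
  - apply smooth_germ_mult; assumption.
  - destruct m as [|m]; [|rewrite (vanishes_value m f Hf); ring].
    destruct n as [|n]; [lia|rewrite (vanishes_value n g Hg); ring].
  - apply (vanishes_ext s (fun x y => dx f x y * g x y + f x y * dx g x y)).
    + apply germ_eq_box; exists d; intros x y Hxy; symmetry.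
      apply (derivatives_mult (box d)); auto using box_open.
    + apply vanishes_plus.
      * apply (IH (pred m) n); auto using vanishes_dx; lia.
      * apply (IH m (pred n)); auto using vanishes_dx; lia.
  - apply (vanishes_ext s (fun x y => dy f x y * g x y + f x y * dy g x y)).
    + apply germ_eq_box; exists d; intros x y Hxy; symmetry.
      apply (derivatives_mult (box d)); auto using box_open.
    + apply vanishes_plus.
      * apply (IH (pred m) n); auto using vanishes_dy; lia.
      * apply (IH m (pred n)); auto using vanishes_dy; lia.
Qed.

Lemma vanishes_0 n : vanishes n (fun _ _ => 0).
Proof.
  induction n as [|n IH]; [apply smooth_germ_const|].
  split; [apply smooth_germ_const|split; [reflexivity|split]];
    apply (vanishes_ext n (fun _ _ => 0)); auto; apply locally_2d_forall; intros u v;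
    symmetry; apply (Derive_const 0).
Qed.

Lemma m2_vanishes f : m2 f -> vanishes 1 f.
Proof.
  intros [S Z]; split; [exact S|split; [exact Z|split]].
  - apply smooth_germ_dx, S.
  - apply smooth_germ_dy, S.
Qed.

(** Order is additive on products and does not drop in sums. *)
Lemma ideal_pow_vanishes n f : ideal_pow m2 n f -> vanishes n f.
Proof.
  revert f; induction n as [|n IH]; intros f; [auto|].
  intros [l [Hl E]]; apply germ_eq_sym in E; apply (vanishes_ext _ _ _ E); clear E.
  induction Hl as [|[u v] l [Hu Hv] _ IHl]; simpl map; simpl fold_right.
  - apply vanishes_0.
  - apply (vanishes_plus _ (fun x y => u x y * v x y)); [|exact IHl].
    apply (vanishes_mult _ 1 n); auto using m2_vanishes.
Qed.

Lemma vanishes_pow n m f : vanishes n f -> vanishes (m * n) (fun x y => f x y ^ m).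
Proof.
  intros Hf; induction m as [|m IH]; [exact (smooth_germ_const 1)|].
  apply (vanishes_mult _ n (m * n) f (fun x y => f x y ^ m)); auto.
Qed.

Lemma m2_fst : m2 (fun x _ => x).
Proof.
  split; [|reflexivity].
  apply (smooth_germ_of_smooth_on 1); [lra|apply smooth_on_fst, box_open].
Qed.

Lemma m2_snd : m2 (fun _ y => y).
Proof.
  split; [|reflexivity].
  apply (smooth_germ_of_smooth_on 1); [lra|apply smooth_on_snd, box_open].
Qed.

Lemma hom_poly_vanishes k a : vanishes k (hom_poly k a).
Proof.
  assert (H : forall n, (n <= k)%nat -> vanishes k (fun x y =>
    sum_f_R0 (fun i => a i * x ^ (k - i) * y ^ i) n)).
  { assert (M : forall i, (i <= k)%nat -> vanishes k (fun x y => a i * x ^ (k - i) * y ^ i)).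
    { intros i Hi; apply (vanishes_mult k (k - i) i); [lia| |].
      - apply (vanishes_mult (k - i) 0 (k - i)); [lia|apply (smooth_germ_const (a i))|].
        rewrite <- (Nat.mul_1_r (k - i)) at 1.
        apply (vanishes_pow 1 (k - i) (fun x _ => x)), m2_vanishes, m2_fst.
      - rewrite <- (Nat.mul_1_r i) at 1.
        apply (vanishes_pow 1 i (fun _ y => y)), m2_vanishes, m2_snd. }
    induction n as [|n IH]; intros Hn; [apply (M 0%nat Hn)|].
    apply (vanishes_plus k (fun x y => sum_f_R0 (fun i => a i * x ^ (k - i) * y ^ i) n)
      (fun x y => a (S n) * x ^ (k - S n) * y ^ S n)); [apply IH; lia|apply M, Hn]. }
  apply H; lia.
Qed.

Lemma vanishes_wirtinger n i j F : (i + j < n)%nat ->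
  vanishes n (re F) -> vanishes n (im F) -> wirtinger i j F 0 0 = 0.
Proof.
  assert (Hz : forall F n, vanishes n (re F) -> vanishes n (im F) ->
    vanishes (pred n) (re (Dz F)) /\ vanishes (pred n) (im (Dz F))).
  { clear; intros F n V1 V2; split; apply (vanishes_lincomb (pred n));
      auto using vanishes_dx, vanishes_dy. }
  assert (Hzb : forall F n, vanishes n (re F) -> vanishes n (im F) ->
    vanishes (pred n) (re (Dzb F)) /\ vanishes (pred n) (im (Dzb F))).
  { clear; intros F n V1 V2; split; apply (vanishes_lincomb (pred n));
      auto using vanishes_dx, vanishes_dy. }
  assert (HD : forall i j n, vanishes n (re F) -> vanishes n (im F) ->
    vanishes (n - (i + j)) (re (wirtinger i j F)) /\ vanishes (n - (i + j)) (im (wirtinger i j F))).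
  { clear i j n; intros i j n V1 V2; induction i as [|i IH].
    - induction j as [|j IH]; [rewrite Nat.sub_0_r; auto|].
      replace (n - (0 + S j))%nat with (pred (n - (0 + j))) by lia.
      apply (Hzb (Nat.iter j Dzb F)); apply IH.
    - replace (n - (S i + j))%nat with (pred (n - (i + j))) by lia.
      apply (Hz (wirtinger i j F)); apply IH. }
  intros Hij V1 V2; destruct (HD i j n V1 V2) as [W1 W2].
  replace (n - (i + j))%nat with (S (n - (i + j) - 1)) in W1, W2 by lia.
  apply vanishes_value in W1, W2; unfold re, im in W1, W2.
  apply injective_projections; assumption.
Qed.

(** * Divisibility by the power of z *)

Lemma monomial_origin i j : (0 < i + j)%nat -> monomial i j 0 0 = 0.
Proof.
  assert (Z0 : zz 0 0 = RtoC 0) by reflexivity.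
  assert (Z1 : Cconj (zz 0 0) = RtoC 0)
    by (unfold Cconj, zz, RtoC; simpl; rewrite Ropp_0; reflexivity).
  intros Hij; unfold monomial; rewrite Z1, Z0.
  destruct i as [|i]; [destruct j as [|j]; [lia|]|]; rewrite Cpow_S; ring.
Qed.

(** Membership in the ideal generated by z^k and its conjugate is decided by
    the support of the Taylor expansion in degrees less than 2k, since a
    monomial of degree at least 2k has an exponent at least k. When [strict]
    holds, the cofactors can moreover be taken to vanish at the origin; one
    statement thus serves both for h, where they do not vanish, and for R. *)
Lemma conjugate_power_ideal (strict : Prop) k d F : (1 <= k)%nat -> 0 < d ->
  csmooth_on (box d) F ->
  (forall i j, wirtinger i j F 0 0 = 0 \/ ((k <= i \/ k <= j) /\ (strict -> k < i + j))%nat) ->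
  exists A B, csmooth_on (box d) A /\ csmooth_on (box d) B /\
    (strict -> A 0 0 = 0 /\ B 0 0 = 0) /\
    forall x y, box d x y ->
      F x y = (zz x y ^ k * A x y + Cconj (zz x y) ^ k * B x y)%C.
Proof.
  intros Hk Hd HF Hco.
  pose proof (box_open d) as HO.
  set (J := fun F : R -> R -> C => exists A B, csmooth_on (box d) A /\ csmooth_on (box d) B /\
    (strict -> A 0 0 = 0 /\ B 0 0 = 0) /\
    forall x y, box d x y ->
      F x y = (zz x y ^ k * A x y + Cconj (zz x y) ^ k * B x y)%C).
  change (J F).
  assert (Hmono : forall i j G, csmooth_on (box d) G ->
    ((k <= i \/ k <= j) /\ (strict -> k < i + j))%nat ->
    J (fun x y => monomial i j x y * G x y)%C).
  { intros i j G HG [[Hi|Hj] Hs].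
    - exists (fun x y => monomial (i - k) j x y * G x y)%C, (fun _ _ => RtoC 0).
      split; [|split; [|split]]; auto using csmooth_on_const, csmooth_on_mult, csmooth_on_monomial.
      + intros st; rewrite monomial_origin by (specialize (Hs st); lia).
        split; [ring|reflexivity].
      + intros x y _; unfold monomial.
        replace i with (k + (i - k))%nat at 1 by lia; rewrite Cpow_add_r; ring.
    - exists (fun _ _ => RtoC 0), (fun x y => monomial i (j - k) x y * G x y)%C.
      split; [|split; [|split]]; auto using csmooth_on_const, csmooth_on_mult, csmooth_on_monomial.
      + intros st; rewrite monomial_origin by (specialize (Hs st); lia).
        split; [reflexivity|ring].
      + intros x y _; unfold monomial.
        replace j with (k + (j - k))%nat at 1 by lia; rewrite Cpow_add_r; ring. }
  apply (taylor_membership d (2 * k) J F Hd HF).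
  - intros G H E [A [B [HA [HB [Hs HG]]]]]; exists A, B.
    split; [|split; [|split]]; auto; intros x y Hxy; rewrite <- E; auto.
  - intros G H [A [B [HA [HB [Hs HG]]]]] [A' [B' [HA' [HB' [Hs' HG']]]]].
    exists (fun x y => A x y + A' x y)%C, (fun x y => B x y + B' x y)%C.
    split; [|split; [|split]]; auto using csmooth_on_plus.
    + intros st; destruct (Hs st) as [-> ->]; destruct (Hs' st) as [-> ->]; split; ring.
    + intros x y Hxy; rewrite HG, HG' by assumption; ring.
  - intros i j G Hij HG; apply Hmono; [exact HG|split; lia].
  - intros i j c _; destruct (Hco i j) as [Z|Hij].
    + exists (fun _ _ => RtoC 0), (fun _ _ => RtoC 0).
      split; [|split; [|split]]; auto using csmooth_on_const.
      intros x y _; rewrite Z; ring.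
    + apply (Hmono i j (fun _ _ => c * wirtinger i j F 0 0)%C); auto using csmooth_on_const.
Qed.

Definition complexify (f : R -> R -> R) (x y : R) : C := RtoC (f x y).

Lemma csmooth_on_complexify U f : smooth_on U f -> csmooth_on U (complexify f).
Proof. intros Hf; split; [exact Hf|exact (smooth_on_const U 0)]. Qed.

(** If f = z^k A + w^k B is real, with w the conjugate of z, then taking real
    parts turns w^k B into the real part of z^k times the conjugate of B. *)
Lemma real_part_of_power_multiple (strict : Prop) k d f : (1 <= k)%nat -> 0 < d ->
  smooth_on (box d) f ->
  (forall i j, wirtinger i j (complexify f) 0 0 = 0 \/
     ((k <= i \/ k <= j) /\ (strict -> k < i + j))%nat) ->
  exists A, csmooth_on (box d) A /\ (strict -> A 0 0 = 0) /\
    forall x y, box d x y -> f x y = Re (zz x y ^ k * A x y)%C.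
Proof.
  intros Hk Hd Hf Hco.
  destruct (conjugate_power_ideal strict k d (complexify f) Hk Hd
    (csmooth_on_complexify _ _ Hf) Hco) as [A [B [HA [HB [Hs E]]]]].
  exists (fun x y => A x y + Cconj (B x y))%C; split; [|split].
  - apply csmooth_on_plus; [exact HA|apply csmooth_on_conj; auto using box_open].
  - intros st; destruct (Hs st) as [-> ->].
    unfold Cconj, Cplus, RtoC; simpl; f_equal; ring.
  - intros x y Hxy; specialize (E x y Hxy); unfold complexify in E.
    apply (f_equal Re) in E; rewrite re_RtoC in E; rewrite E.
    rewrite <- Cpow_conj; set (w := (zz x y ^ k)%C).
    unfold Cconj, Cmult, Cplus, Re; simpl; ring.
Qed.

(** The order of vanishing excludes the low total degrees, and p-harmonicity
    excludes the derivatives that factor through the one of type (p, p). *)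
Lemma taylor_support U p n f : open_plane U -> U 0 0 -> smooth_on U f -> vanishes n f ->
  eq_on U (wirtinger p p (complexify f)) (fun _ _ => 0) ->
  forall i j, wirtinger i j (complexify f) 0 0 = 0 \/ ((i < p \/ j < p) /\ n <= i + j)%nat.
Proof.
  intros HU H0 Hf Hv Hp i j.
  destruct (Nat.lt_ge_cases (i + j) n) as [Hn|Hn].
  { left; apply (vanishes_wirtinger n); auto.
    apply (vanishes_0 n). }
  destruct (Nat.lt_ge_cases i p) as [Hi|Hi]; [right; lia|].
  destruct (Nat.lt_ge_cases j p) as [Hj|Hj]; [right; lia|left].
  replace i with (i - p + p)%nat by lia; replace j with (j - p + p)%nat by lia.
  rewrite (wirtinger_add U _ _ _ _ _ HU (csmooth_on_complexify U f Hf) 0 0 H0).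
  apply (wirtinger_zero U _ _ _ HU Hp 0 0 H0).
Qed.

Lemma wirtinger_11_laplacian U f : open_plane U -> smooth_on U f ->
  eq_on U (wirtinger 1 1 (complexify f)) (complexify (fun x y => / 4 * laplacian f x y)).
Proof.
  intros HU Hf; apply eq_on_trans with (wirtinger 1 1 (fun x y => RtoC (1 * f x y))).
  - apply Dz_ext, Dzb_ext; auto; intros x y _; unfold complexify; f_equal; ring.
  - apply eq_on_trans with (1 := Dz_Dzb_laplacian U 1 f HU Hf).
    intros x y _; unfold complexify; f_equal; field.
Qed.

Lemma smooth_on_laplacian U f : open_plane U -> smooth_on U f -> smooth_on U (laplacian f).
Proof.
  intros HU Hf; apply (smooth_on_plus U (dx (dx f)) (dy (dy f)));
    auto using smooth_on_dx, smooth_on_dy.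
Qed.

Lemma wirtinger_22_bilaplacian U f : open_plane U -> smooth_on U f ->
  eq_on U (wirtinger 2 2 (complexify f))
    (complexify (fun x y => / 16 * laplacian (laplacian f) x y)).
Proof.
  intros HU Hf.
  assert (HF := csmooth_on_complexify U f Hf).
  apply eq_on_trans with (1 := wirtinger_add U 1 1 1 1 _ HU HF).
  apply eq_on_trans with (wirtinger 1 1 (fun x y => RtoC (/ 4 * laplacian f x y))).
  - apply Dz_ext, Dzb_ext; auto; apply wirtinger_11_laplacian; assumption.
  - apply eq_on_trans with
      (1 := Dz_Dzb_laplacian U (/ 4) (laplacian f) HU (smooth_on_laplacian U f HU Hf)).
    intros x y _; unfold complexify; f_equal; field.
Qed.

(** The constant term satisfies |a 0| <= M y for all small y > 0, so it is zero;
    then divide by y. *)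
Lemma real_polynomial_zero n a :
  (forall y, 0 < y -> sum_f_R0 (fun i => a i * y ^ i) n = 0) ->
  forall i, (i <= n)%nat -> a i = 0.
Proof.
  revert a; induction n as [|n IH]; intros a Ha.
  - intros i Hi; replace i with 0%nat by lia.
    specialize (Ha 1 Rlt_0_1); simpl in Ha; lra.
  - set (q := fun y => sum_f_R0 (fun i => a (S i) * y ^ i) n).
    assert (Hq : forall y, 0 < y -> a 0%nat + y * q y = 0).
    { intros y Hy; rewrite <- (Ha y Hy), decomp_sum by lia; simpl pred; unfold q.
      rewrite scal_sum; simpl; f_equal; [ring|].
      apply sum_eq; intros; ring. }
    set (M := sum_f_R0 (fun i => Rabs (a (S i))) n).
    assert (HM : forall y, 0 < y <= 1 -> Rabs (q y) <= M).
    { intros y Hy; apply Rle_trans with (1 := Rsum_abs _ _).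
      apply sum_Rle; intros i _; rewrite Rabs_mult.
      apply Rle_trans with (Rabs (a (S i)) * 1); [|right; ring].
      apply Rmult_le_compat_l; [apply Rabs_pos|].
      rewrite Rabs_pos_eq by (apply pow_le; lra).
      rewrite <- (pow1 i); apply pow_incr; lra. }
    assert (M0 : 0 <= M) by (apply cond_pos_sum; intros; apply Rabs_pos).
    assert (A0 : a 0%nat = 0).
    { apply Rabs_eq_0, Rle_antisym; [|apply Rabs_pos].
      apply Rnot_lt_le; intros Hlt.
      set (y := Rmin 1 (Rabs (a 0%nat) / (M + 1))).
      assert (Hy : 0 < y <= 1).
      { split; [apply Rmin_pos; [lra|apply Rdiv_lt_0_compat; lra]|apply Rmin_l]. }
      assert (Hy' : y * (M + 1) <= Rabs (a 0%nat)).
      { apply Rle_trans with (Rabs (a 0%nat) / (M + 1) * (M + 1)).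
        - apply Rmult_le_compat_r; [lra|apply Rmin_r].
        - right; field; lra. }
      specialize (Hq y (proj1 Hy)); specialize (HM y Hy).
      replace (a 0%nat) with (- (y * q y)) in Hy' by lra.
      rewrite Rabs_Ropp, Rabs_mult, (Rabs_pos_eq y) in Hy' by lra.
      nra. }
    intros [|i] Hi; [exact A0|].
    apply (IH (fun i => a (S i))); [|lia].
    intros y Hy; specialize (Hq y Hy); rewrite A0, Rplus_0_l in Hq.
    apply Rmult_integral in Hq; destruct Hq as [Hq|Hq]; [lra|exact Hq].
Qed.

Lemma hom_poly_smooth U k a : open_plane U -> smooth_on U (hom_poly k a).
Proof.
  intros HU.
  assert (P : forall f n, smooth_on U f -> smooth_on U (fun x y => f x y ^ n)).
  { intros f n Hf; induction n as [|n IH]; [exact (smooth_on_const U 1)|].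
    apply (smooth_on_mult U f (fun x y => f x y ^ n)); assumption. }
  assert (H : forall n, smooth_on U (fun x y =>
    sum_f_R0 (fun i => a i * x ^ (k - i) * y ^ i) n)).
  { assert (M : forall i, smooth_on U (fun x y => a i * x ^ (k - i) * y ^ i)).
    { intros i; apply (smooth_on_mult U (fun x y => a i * x ^ (k - i))).
      - apply smooth_on_mult; [apply smooth_on_const|].
        apply (P (fun x _ => x)), smooth_on_fst, HU.
      - apply (P (fun _ y => y)), smooth_on_snd, HU. }
    induction n as [|n IH]; [exact (M 0%nat)|].
    apply (smooth_on_plus U (fun x y => sum_f_R0 (fun i => a i * x ^ (k - i) * y ^ i) n)
      (fun x y => a (S n) * x ^ (k - S n) * y ^ S n)); auto. }
  apply H.
Qed.

Lemma hom_poly_scale k a t x y : hom_poly k a (t * x) (t * y) = t ^ k * hom_poly k a x y.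
Proof.
  unfold hom_poly; rewrite scal_sum; apply sum_eq; intros i Hi.
  replace (t ^ k) with (t ^ (k - i) * t ^ i) by (rewrite <- pow_add; f_equal; lia).
  rewrite !Rpow_mult_distr; ring.
Qed.

(** The ideal membership only gives h = Re (z^k A) with A a function. By
    homogeneity A may be replaced by its value at (tx, ty) for every small t,
    hence by its value at the origin. *)
Lemma harmonic_form k a : (1 <= k)%nat -> harmonic (hom_poly k a) ->
  (exists i, (i <= k)%nat /\ a i <> 0) ->
  exists c : C, c <> 0 /\ forall x y, hom_poly k a x y = Re (zz x y ^ k * c)%C.
Proof.
  intros Hk Hh Ha.
  set (h := hom_poly k a) in *.
  assert (HO := box_open 1).
  assert (Sh : smooth_on (box 1) h) by (apply hom_poly_smooth, HO).
  assert (H0 : box 1 0 0) by (split; rewrite Rabs_R0; lra).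
  destruct (real_part_of_power_multiple False k 1 h Hk Rlt_0_1 Sh) as [A [HA [_ E]]].
  { intros i j; destruct (taylor_support (box 1) 1 k h HO H0 Sh) with (i := i) (j := j)
      as [Z|Z]; [apply hom_poly_vanishes| |left; exact Z|right; split; [lia|tauto]].
    apply eq_on_trans with (1 := wirtinger_11_laplacian _ h HO Sh).
    intros x y _; unfold complexify; rewrite Hh; f_equal; ring. }
  assert (form : forall x y, h x y = Re (zz x y ^ k * A 0 0)%C).
  { intros x y; set (w := (zz x y ^ k)%C).
    assert (ray : forall t, 0 < t -> box 1 (t * x) (t * y) ->
      h x y = Re (Cmult w (A (t * x) (t * y)))).
    { intros t Ht Hb; specialize (E _ _ Hb); unfold h in E; rewrite hom_poly_scale in E.
      replace (zz (t * x) (t * y)) with (Cmult (RtoC t) (zz x y)) in E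
        by (unfold zz, RtoC, Cmult; simpl; f_equal; ring).
      rewrite Cpow_mult_l, <- RtoC_pow in E; fold w in E.
      rewrite <- Cmult_assoc, re_scal_l in E.
      apply Rmult_eq_reg_l in E; [exact E|apply pow_nonzero; lra]. }
    set (g := fun u v => Re w * re A u v - Im w * im A u v).
    assert (Sg : smooth_on (box 1) g).
    { destruct HA as [A1 A2]; apply smooth_on_minus; auto;
        apply smooth_on_mult; auto using smooth_on_const. }
    assert (Hg : forall u v, Re (w * A u v)%C = g u v) by reflexivity.
    rewrite Hg; apply Rminus_diag_uniq.
    destruct (Req_dec (h x y - g 0 0) 0) as [Z|Z]; [exact Z|exfalso].
    apply Rabs_pos_lt in Z.
    destruct (smooth_on_continuous _ _ _ _ HO Sg H0 (mkposreal _ Z)) as [e He].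
    simpl in He.
    (* With t = m / s, the point (tx, ty) lies in the box and within e of 0. *)
    set (m := Rmin 1 e); set (s := Rabs x + Rabs y + 1).
    pose proof (Rabs_pos x); pose proof (Rabs_pos y).
    assert (Hs : 0 < s) by (unfold s; lra).
    assert (Hm : 0 < m) by (apply Rmin_pos; [lra|apply cond_pos]).
    assert (Ht : 0 < m / s) by (apply Rdiv_lt_0_compat; assumption).
    assert (small : forall u, Rabs u < s -> Rabs (m / s * u) < m).
    { intros u Hu; rewrite Rabs_mult, (Rabs_pos_eq (m / s)) by lra.
      apply Rlt_le_trans with (m / s * s); [apply Rmult_lt_compat_l; assumption|].
      right; field; lra. }
    assert (Sx := small x ltac:(unfold s; lra)); assert (Sy := small y ltac:(unfold s; lra)).
    pose proof (Rmin_l 1 e) as L1; pose proof (Rmin_r 1 e) as L2; fold m in L1, L2.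
    specialize (He (m / s * x) (m / s * y)); rewrite !Rminus_0_r in He.
    rewrite <- Hg, <- (ray (m / s) Ht) in He by (split; lra).
    specialize (He ltac:(lra) ltac:(lra)); lra. }
  exists (A 0 0); split; [|exact form].
  intros HA0; destruct Ha as [i [Hi Hai]]; apply Hai.
  apply (real_polynomial_zero k a); [|exact Hi].
  intros y _; rewrite HA0 in form; specialize (form 1 y).
  rewrite Cmult_0_r in form; simpl in form; rewrite <- form; unfold h, hom_poly.
  apply sum_eq; intros j Hj; rewrite pow1; ring.
Qed.

(** * Roots of units and the right equivalence *)

(** The map z |-> z (1 + v), in coordinates: the perturbation z v is a product
    of two functions vanishing at the origin, so its derivative there is
    zero. *)
Lemma diffeo_germ_unit_multiple v1 v2 : m2 v1 -> m2 v2 ->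
  diffeo_germ (fun x y => x + (x * v1 x y - y * v2 x y))
              (fun x y => y + (x * v2 x y + y * v1 x y)).
Proof.
  intros H1 H2.
  assert (prod : forall f v, m2 f -> m2 v -> vanishes 2 (fun x y => f x y * v x y))
    by (intros f v Hf Hv; apply (vanishes_mult 2 1 1); auto using m2_vanishes).
  assert (V1 : vanishes 2 (fun x y => x * v1 x y - y * v2 x y)).
  { apply (vanishes_ext 2 (fun x y => 1 * (x * v1 x y) + (-1) * (y * v2 x y))).
    - apply locally_2d_forall; intros; ring.
    - apply (vanishes_lincomb 2 1 (-1) (fun x y => x * v1 x y) (fun x y => y * v2 x y));
        apply prod; auto using m2_fst, m2_snd. }
  assert (V2 : vanishes 2 (fun x y => x * v2 x y + y * v1 x y)).
  { apply (vanishes_plus 2 (fun x y => x * v2 x y) (fun x y => y * v1 x y));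
      apply prod; auto using m2_fst, m2_snd. }
  destruct V1 as [S1 [Z1 [[_ [X1 _]] [_ [Y1 _]]]]].
  destruct V2 as [S2 [Z2 [[_ [X2 _]] [_ [Y2 _]]]]].
  apply diffeo_germ_of_tangent_identity; assumption.
Qed.

Lemma power_second_order U k : open_plane U -> exists P, csmooth_on U P /\
  forall x y, ((1 + zz x y) ^ k = 1 + INR k * zz x y + zz x y * zz x y * P x y)%C.
Proof.
  intros HU; induction k as [|k [P [HP E]]].
  - exists (fun _ _ => RtoC 0); split; [apply csmooth_on_const|].
    intros x y; simpl; ring.
  - exists (fun x y => INR k + P x y + zz x y * P x y)%C; split.
    + apply csmooth_on_plus; [apply csmooth_on_plus|apply csmooth_on_mult];
        auto using csmooth_on_const, csmooth_on_zz.
    + intros x y; rewrite Cpow_S, E, S_INR, RtoC_plus; ring.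
Qed.

(** If g inverts z |-> ((1 + z)^k - 1) / k, then v = g (u / k) satisfies
    (1 + v)^k = 1 + u. The map to be inverted has the form z (1 + Q) because
    (1 + z)^k = 1 + k z + z^2 P. *)
Lemma complex_root_germ k u1 u2 : (1 <= k)%nat -> m2 u1 -> m2 u2 ->
  exists v1 v2, m2 v1 /\ m2 v2 /\
  locally_2d (fun x y => ((1 + (v1 x y, v2 x y)) ^ k = 1 + (u1 x y, u2 x y))%C) 0 0.
Proof.
  intros Hk Hu1 Hu2.
  destruct (power_second_order (box 1) k (box_open 1)) as [P [HP E]].
  assert (Hk0 : RtoC (INR k) <> 0).
  { intros H; apply RtoC_inj in H; revert H; apply not_0_INR; lia. }
  assert (Hk1 : INR k <> 0) by (apply not_0_INR; lia).
  set (Q := fun x y => (zz x y * (/ INR k * P x y))%C).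
  assert (HQ : csmooth_on (box 1) Q).
  { assert (HO := box_open 1).
    repeat apply csmooth_on_mult; auto using csmooth_on_zz.
    exact (csmooth_on_const _ (/ INR k)%C). }
  assert (Q0 : Q 0 0 = 0).
  { unfold Q; replace (zz 0 0) with (RtoC 0) by reflexivity; ring. }
  assert (Q1 : m2 (re Q)).
  { split; [apply (smooth_germ_of_smooth_on 1); [lra|apply HQ]|].
    unfold re; rewrite Q0; reflexivity. }
  assert (Q2 : m2 (im Q)).
  { split; [apply (smooth_germ_of_smooth_on 1); [lra|apply HQ]|].
    unfold im; rewrite Q0; reflexivity. }
  destruct (diffeo_germ_unit_multiple _ _ Q1 Q2)
    as [_ [g1 [g2 [[G1 G2] [_ [_ [I1 I2]]]]]]].
  set (w1 := fun x y => / INR k * u1 x y); set (w2 := fun x y => / INR k * u2 x y).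
  assert (scale : forall u, m2 u -> m2 (fun x y => / INR k * u x y)).
  { intros u [Su Zu]; split; [|rewrite Zu; ring].
    apply (smooth_germ_mult (fun _ _ => / INR k)); auto using smooth_germ_const. }
  assert (W1 := scale u1 Hu1 : m2 w1); assert (W2 := scale u2 Hu2 : m2 w2).
  assert (comp : forall g, m2 g -> m2 (fun x y => g (w1 x y) (w2 x y))).
  { intros g [Sg Zg]; split; [apply smooth_germ_comp; assumption|].
    rewrite (proj2 W1), (proj2 W2); exact Zg. }
  exists (fun x y => g1 (w1 x y) (w2 x y)), (fun x y => g2 (w1 x y) (w2 x y)).
  split; [apply comp, G1|split; [apply comp, G2|]].
  assert (I := locally_2d_and _ _ _ _ I1 I2); destruct I as [d I].
  assert (Hd2 : 0 < d / 2) by (pose proof (cond_pos d); lra).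
  destruct (smooth_germ_small w1 _ (proj1 W1) (proj2 W1) Hd2) as [r1 R1].
  destruct (smooth_germ_small w2 _ (proj1 W2) (proj2 W2) Hd2) as [r2 R2].
  assert (Hr : 0 < Rmin r1 r2) by (apply Rmin_pos; apply cond_pos).
  exists (mkposreal _ Hr); simpl; intros x y Hx Hy; rewrite Rminus_0_r in Hx, Hy.
  pose proof (Rmin_l r1 r2); pose proof (Rmin_r r1 r2).
  specialize (R1 x y ltac:(split; lra)); specialize (R2 x y ltac:(split; lra)).
  destruct (I (w1 x y) (w2 x y)) as [J1 J2]; try (rewrite Rminus_0_r; lra).
  cbv beta in J1, J2.
  set (p := g1 (w1 x y) (w2 x y)) in *; set (q := g2 (w1 x y) (w2 x y)) in *.
  change (p, q) with (zz p q); rewrite E.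
  assert (K : (zz p q + zz p q * Q p q = (w1 x y, w2 x y))%C)
    by (rewrite <- J1, <- J2; unfold zz, Cmult, Cplus; reflexivity).
  transitivity (1 + INR k * (zz p q + zz p q * Q p q))%C.
  - unfold Q; field; exact Hk0.
  - rewrite K; unfold w1, w2, Cplus, Cmult, RtoC; simpl; f_equal; field; exact Hk1.
Qed.

Theorem corollary1 (k : nat) (hk : (5 <= k)%nat)
  (a : nat -> R)
  (a_nonzero : exists i : nat, (i <= k)%nat /\ a i <> 0)
  (h_harmonic : harmonic (hom_poly k a))
  (r : R -> R -> R)
  (r_smooth : smooth_germ r)
  (r_order : order_more_than k r)
  (r_biharmonic : germ_eq (laplacian (laplacian r)) (fun _ _ => 0)) :
  right_equivalent (hom_poly k a) (fun x y => hom_poly k a x y + r x y).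
Proof.
  assert (Hk : (1 <= k)%nat) by lia.
  destruct (harmonic_form k a Hk h_harmonic a_nonzero) as [c [Hc Hh]].
  apply smooth_germ_iff in r_smooth; destruct r_smooth as [d1 S1].
  apply germ_eq_box in r_biharmonic; destruct r_biharmonic as [d2 B2].
  set (d := Rmin d1 d2).
  assert (Hd : 0 < d) by (apply Rmin_pos; apply cond_pos).
  pose proof (box_open d) as HO.
  assert (H0 : box d 0 0) by (split; rewrite Rabs_R0; exact Hd).
  assert (Sr : smooth_on (box d) r).
  { apply (smooth_on_sub _ (box d1)); auto; intros x y; apply box_mono, Rmin_l. }
  destruct (real_part_of_power_multiple True k d r Hk Hd Sr) as [A [HA [A0 Er]]].
  { intros i j; destruct (taylor_support (box d) 2 (S k) r HO H0 Sr) with (i := i) (j := j)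
      as [Z|Z]; [apply ideal_pow_vanishes, r_order| |left; exact Z|right; split; lia].
    apply eq_on_trans with (1 := wirtinger_22_bilaplacian _ r HO Sr).
    intros x y Hxy; unfold complexify; rewrite B2; [f_equal; ring|].
    revert Hxy; apply box_mono, Rmin_r. }
  set (u := fun x y => (/ c * A x y)%C).
  assert (Su : csmooth_on (box d) u) by (apply csmooth_on_mult; auto using csmooth_on_const).
  assert (U0 : u 0 0 = 0) by (unfold u; rewrite A0 by exact I; ring).
  destruct (complex_root_germ k (re u) (im u) Hk) as [v1 [v2 [V1 [V2 HV]]]].
  { split; [apply (smooth_germ_of_smooth_on d); [exact Hd|apply Su]|].
    unfold re; rewrite U0; reflexivity. }
  { split; [apply (smooth_germ_of_smooth_on d); [exact Hd|apply Su]|].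
    unfold im; rewrite U0; reflexivity. }
  exists (fun x y => x + (x * v1 x y - y * v2 x y)),
    (fun x y => y + (x * v2 x y + y * v1 x y)).
  split; [apply diffeo_germ_unit_multiple; assumption|].
  destruct HV as [e HV].
  assert (He : 0 < Rmin d e) by (apply Rmin_pos; [exact Hd|apply cond_pos]).
  exists (mkposreal _ He); simpl; intros x y Hx Hy.
  pose proof (Rmin_l d e); pose proof (Rmin_r d e).
  specialize (HV x y ltac:(lra) ltac:(lra)).
  rewrite Rminus_0_r in Hx, Hy.
  rewrite Er by (split; lra).
  rewrite !Hh.
  assert (Hz : zz (x + (x * v1 x y - y * v2 x y)) (y + (x * v2 x y + y * v1 x y))
    = Cmult (zz x y) (1 + (v1 x y, v2 x y))%C)
    by (unfold zz, Cmult, Cplus, RtoC; simpl; f_equal; ring).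
  rewrite Hz, Cpow_mult_l, HV.
  change (re u x y, im u x y) with (Re (u x y), Im (u x y)).
  replace (Re (u x y), Im (u x y)) with (u x y) by (destruct (u x y); reflexivity).
  unfold u.
  transitivity (Re (zz x y ^ k * c + zz x y ^ k * A x y)%C).
  - f_equal; field; exact Hc.
  - reflexivity.
Qed.
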